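(* Let $\mathcal P(L_2)$ be the universal planar algebra generated by a 2-box generator set $L_2$ with exchange relations. Then every connected 0-box $D$ of $\mathcal P(L_2)$ can be evaluated to a scalar $Z(D)$ by a canonical evaluation path.
   Context: Setting: $L_2=\{p_0,\dots,p_n\}$ is a set of 2-box generators (with an involution $i\mapsto\overline i$ such that a disc labelled $p_{\overline i}$ is identified with the $180^\circ$ rotation of a disc labelled $p_i$). $\mathcal P(L_2)$ is the universal planar algebra: $\mathcal P(L_2)_{n,\pm}$ is the linear span of shaded planar tangles with $2n$ boundary points whose input discs are labelled by elements of $L_2$. Shrinking each labelled disc to a crossing, an $n$-box (tangle) is a planar graph with $2n$ boundary 1-valent vertices and with 4-valent internal vertices (crossings) labelled by $L_2$; 0-boxes are closed diagrams. The distinguished (unshaded) side of $p_i$ is its left side. A $k$-face is a face with $k$ vertices (a closed circle without crossings bounds a 0-face); faces may be shaded or unshaded. The empty diagram is a 0-box. Relations (scalars $\delta,c_i,d_i,N_{kj}^i,a_{st}^{ij},b_{\ell m}^{ij}\in\mathbb C$ are given): - circle: a closed circle equals $\delta$; - cap: joining the two upper boundary points of $p_i$ gives $c_i$ times a cap; joining the upper right and lower right points of $p_i$ gives $d_i$ times a strand; - multiplication: $p_i$ stacked vertically with $p_j$ equals $\delta_{ij}p_i$; - convolution: $p_k*p_j=\sum_iN_{kj}^ip_i$, where $p_k*p_j$ places $p_k$ to the left of $p_j$ and joins the right-hand boundary points of $p_k$ to the left-hand ones of $p_j$ (upper to upper, lower to lower); - exchange: $E_1(i,j)=\sum_{s,t}a_{st}^{ij}E_2(s,t)+\sum_{\ell,m}b_{\ell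 m}^{ij}E_3(\ell,m)$, where, stacking left factors on top, $E_1(i,j)=(p_i\otimes1)(1\otimes\mathfrak F_s(p_j))$, $E_2(s,t)=(p_s\otimes1)U(p_t\otimes1)$, $E_3(\ell,m)=(1\otimes\mathfrak F_s(p_\ell))(p_m\otimes1)$; here $x\otimes1$ is $x$ with a through strand added on the right, $1\otimes\mathfrak F_s(x)$ is the $90^\circ$ counterclockwise rotation of $x$ on strands 2,3 with a through strand on the left, and $U$ is through strand 1 with the cup-cap on strands 2,3; - resolution of identity: two parallel vertical strands (unshaded on the left) equal $\sum_ip_i$. Moves on 0-boxes (each replaces a diagram by a linear combination of diagrams; all relations may be applied after planar isotopy/rotation): Move 0 evaluates a 0-face with the circle relation; Move 1 evaluates a 1-face with a cap relation; Move 2 evaluates a 2-face with the multiplication or convolution relation; Move 3 evaluates a 3-face by applying the exchange relation to two of its crossings, so that it becomes a 2-face, and then immediately evaluating that 2-face; Move 4 applies the exchange relation to an $E_1$-configuration; Move 5 applies the resolution of identity. An evaluation path is a concatenation of finitely many moves; it is canonical if it does not contain Moves 4 or 5. A diagram is evaluated to a scalar when it is reduced to a scalar multiple of the empty diagram (the empty diagram has value 1). *)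

(* Defs.v *)
From mathcomp Require Import all_boot all_order all_algebra.
From mathcomp Require Import reals complex.
From Stdlib Require List Relation_Operators.

Set Implicit Arguments.
Unset Strict Implicit.
Unset Printing Implicit Defensive.

Import GRing.Theory.
Local Open Scope ring_scope.

(* A shaded planar diagram is encoded by its combinatorial map.  A dart is an
   end of a strand segment at a vertex, pointing away from the vertex; [edge]
   is the other end of the segment and [node] the next dart counterclockwise
   around the same vertex.  Vertices are crossings (4-valent) or plain points
   on a strand (2-valent); the latter are erased by isotopy, and they allow a
   closed circle to be a map as well.

   A place is a point off the strands: [Some d] lies in the corner between [d]
   and [node d], equivalently on the left of the strand that leaves along [d];
   [None] is the point at infinity.  Places in the same face are in the same
   region.  [tie] declares further pairs of places to be in the same region: it
   records which region is unbounded and, for a disconnected diagram, the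
   regions in which the various components sit.

   [lab d = Some i] means that the corner [Some d] is an unshaded corner of a
   crossing which is p_i when that corner is taken as its distinguished (left)
   side.  Both unshaded corners of a crossing carry a label, so that p_(bar i)
   and the half turn of p_i are literally the same crossing. *)
Record diagram (L : Type) := Diagram {
  dart : finType;
  edge : dart -> dart;
  node : dart -> dart;
  lab : dart -> option L;
  shade : option dart -> bool;
  tie : rel (option dart)
}.

Section Diagrams.

Variable L : eqType.
Variable bar : L -> L.
Implicit Types D E : diagram L.

Definition face D (d : dart D) : dart D := edge (node d).

Definition adjacent D : rel (dart D) :=
  [rel x y | [|| y == edge x, x == edge y, y == node x | x == node y]].

Definition neighbour D : rel (option (dart D)) :=
  [rel x y | [|| tie x y, tie y x |
     match x, y with
     | Some a, Some b => (b == face a) || (a == face b)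
     | _, _ => false
     end]].

Definition same_region D : rel (option (dart D)) := connect (@neighbour D).

Definition vertices D := fcard (@node _ D) (dart D).
Definition edges D := fcard (@edge _ D) (dart D).
Definition faces D := fcard (@face D) (dart D).
Definition components D := n_comp (@adjacent D) (dart D).
Definition regions D := n_comp (@neighbour D) {: option (dart D)}.

(* Components and regions, joined by the faces (each face bounds one region and
   belongs to one component): this is the incidence graph whose connectedness
   is [zb_nested]; with [zb_tree] it is a tree, which is exactly the nesting
   structure of components drawn in the plane. *)
Definition incident D : rel (option (dart D)) :=
  [rel x y | neighbour x y ||
     match x, y with
     | Some a, Some b => adjacent a b
     | _, _ => false
     end].

(* [zb_euler] says that every component has genus 0. *)
Record zero_box_axiom D : Prop := ZeroBoxAxiom {
  zb_edgeK : involutive (@edge _ D);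
  zb_edge_free : forall d : dart D, edge d != d;
  zb_node_inj : injective (@node _ D);
  zb_valence : forall d : dart D, order (@node _ D) d \in [:: 2; 4];
  zb_labelled : forall d : dart D,
    isSome (lab d) = (order (@node _ D) d == 4) && ~~ shade (Some d);
  zb_half_turn : forall d : dart D, lab (node (node d)) = omap bar (lab d);
  zb_shade_region : forall x y : option (dart D),
    neighbour x y -> shade x = shade y;
  zb_shade_edge : forall d : dart D,
    shade (Some (edge d)) = ~~ shade (Some d);
  zb_euler : (vertices D + faces D = edges D + (components D).*2)%N;
  zb_tree : (components D + regions D = faces D + 1)%N;
  zb_nested : forall d : dart D, connect (@incident D) None (Some d)
}.

Record zero_box := ZeroBox {
  zb_diagram :> diagram L;
  zb_axiom : zero_box_axiom zb_diagram
}.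

Definition connected D := forall x y : dart D, connect (@adjacent D) x y.

Definition same_places D E (f : dart D -> dart E) :=
  (forall x, shade (omap f x) = shade x) /\
  (forall x y, same_region (omap f x) (omap f y) = same_region x y).

Definition isomorphic D E :=
  exists f : dart D -> dart E,
    [/\ bijective f,
        forall d, edge (f d) = f (edge d),
        forall d, node (f d) = f (node d),
        forall d, lab (f d) = lab d
      & same_places f].

(* E is D with the 2-valent vertex {u, node u} erased; [edge u != node u]
   excludes the only vertex of a closed circle. *)
Definition smoothing D E :=
  exists (f : dart E -> dart D) (u : dart D),
    [/\ [/\ node (node u) = u, node u != u & edge u != node u],
        injective f /\
        (forall d, (d \in codom f) = (d != u) && (d != node u)),
        forall d, f (edge d) =
          (if edge (f d) == u then edge (node u)
           else if edge (f d) == node u then edge u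
           else edge (f d)),
        (forall d, node (f d) = f (node d)) /\ (forall d, lab (f d) = lab d)
      & same_places f].

Definition isotopy_step D E :=
  [/\ zero_box_axiom D, zero_box_axiom E & isomorphic D E \/ smoothing D E].

Definition isotopic : diagram L -> diagram L -> Prop :=
  Relation_Operators.clos_refl_sym_trans (diagram L) isotopy_step.

(* A diagram with p open ends.  It is used both for a tangle in a disc, with
   the ends numbered clockwise from the distinguished (left) interval of the
   boundary, and for the outside of such a disc, with the ends numbered in the
   same way around the hole.  [node] at the open ends and, for a tangle in a
   disc, the place [None] have no meaning and are never used. *)
Record tangle (p : nat) := Tangle {
  body :> diagram L;
  pt : 'I_p -> dart body
}.

(* The tangle T plugged into the hole of X: the i-th ends are glued into a
   2-valent vertex. *)
Definition plug p (X T : tangle p) : diagram L :=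
  @Diagram L (dart X + dart T)%type
    (fun d => match d with
              | inl x => inl (edge x)
              | inr y => inr (edge y)
              end)
    (fun d => match d with
              | inl x => if [pick i | pt X i == x] is Some i
                         then inr (pt T i) else inl (node x)
              | inr y => if [pick i | pt T i == y] is Some i
                         then inl (pt X i) else inr (node y)
              end)
    (fun d => match d with inl x => lab x | inr y => lab y end)
    (fun q => match q with
              | None => shade (None : option (dart X))
              | Some (inl x) => shade (Some x)
              | Some (inr y) => shade (Some y)
              end)
    (fun q r => match q, r with
                | None, None => tie (None : option (dart X)) None
                | None, Some (inl b) => tie None (Some b)
                | Some (inl a), None => tie (Some a) None
                | Some (inl a), Some (inl b) => tie (Some a) (Some b)
                | Some (inr a), Some (inr b) => tie (Some a) (Some b)
                | _, _ => false
                end).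

(* D together with a closed circle placed in the region of q and bounding an
   empty disc; [Some (inr true)] is outside of the circle, [Some (inr false)]
   inside. *)
Definition add_circle D (q : option (dart D)) : diagram L :=
  @Diagram L (dart D + bool)%type
    (fun d => match d with inl x => inl (edge x) | inr b => inr (~~ b) end)
    (fun d => match d with inl x => inl (node x) | inr b => inr (~~ b) end)
    (fun d => match d with inl x => lab x | inr b => None end)
    (fun r => match r with
              | None => shade (None : option (dart D))
              | Some (inl x) => shade (Some x)
              | Some (inr b) => if b then shade q else ~~ shade q
              end)
    (fun r s => match r, s with
                | None, None => tie (None : option (dart D)) None
                | None, Some (inl b) => tie None (Some b)
                | Some (inl a), None => tie (Some a) None
                | Some (inl a), Some (inl b) => tie (Some a) (Some b)
                | None, Some (inr true) => q == None
                | Some (inl a), Some (inr true) => q == Some a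
                | _, _ => false
                end).

(* The tangle with crossings indexed by K and p ends whose strand segments are
   listed in w.  The four ends of a crossing are numbered counterclockwise from
   the upper left one, so that the distinguished corner is the corner of end 0,
   the corners of ends 0 and 2 being unshaded.  The interval of the boundary
   that precedes end 0 is unshaded.  All the strands of t are on the boundary
   of one region, on their left when they leave the listed ends. *)
Definition tdart (K : finType) (p : nat) := (K * 'I_4 + 'I_p)%type.

Definition mate (T : eqType) (w : seq (T * T)) (d : T) : T :=
  head d ([seq e.2 | e <- w & e.1 == d] ++ [seq e.1 | e <- w & e.2 == d]).

Definition wired (K : finType) (p : nat) (l : K -> L)
    (w : seq (tdart K p * tdart K p)) (t : seq (tdart K p)) : tangle p :=
  @Tangle p
    (@Diagram L (tdart K p)
       (mate w)
       (fun d => match d with inl (k, r) => inl (k, ordS r) | inr i => inr i end)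
       (fun d => match d with
                 | inl (k, r) => if r == 0 :> nat then Some (l k)
                                 else if r == 2 :> nat then Some (bar (l k))
                                 else None
                 | inr i => None
                 end)
       (fun q => match q with
                 | Some (inl (k, r)) => odd r
                 | Some (inr i) => ~~ odd i
                 | None => false
                 end)
       (fun q r => match q, r with
                   | Some a, Some b => (a \in t) && (b \in t)
                   | _, _ => false
                   end))
    (fun i => inr i).

(* Ends of crossing k (upper left, lower left, lower right, upper right). *)
Definition UL (K : finType) p (k : K) : tdart K p := inl (k, @Ordinal 4 0 isT).
Definition LL (K : finType) p (k : K) : tdart K p := inl (k, @Ordinal 4 1 isT).
Definition LR (K : finType) p (k : K) : tdart K p := inl (k, @Ordinal 4 2 isT).
Definition UR (K : finType) p (k : K) : tdart K p := inl (k, @Ordinal 4 3 isT).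

(* Open ends.  With two ends: first and second clockwise from the left.  With
   four and six ends: tops from left to right, then bottoms from right to
   left. *)
Definition A1 (K : finType) : tdart K 2 := inr (@Ordinal 2 0 isT).
Definition A2 (K : finType) : tdart K 2 := inr (@Ordinal 2 1 isT).
Definition t1 (K : finType) : tdart K 4 := inr (@Ordinal 4 0 isT).
Definition t2 (K : finType) : tdart K 4 := inr (@Ordinal 4 1 isT).
Definition b2 (K : finType) : tdart K 4 := inr (@Ordinal 4 2 isT).
Definition b1 (K : finType) : tdart K 4 := inr (@Ordinal 4 3 isT).
Definition T1 (K : finType) : tdart K 6 := inr (@Ordinal 6 0 isT).
Definition T2 (K : finType) : tdart K 6 := inr (@Ordinal 6 1 isT).
Definition T3 (K : finType) : tdart K 6 := inr (@Ordinal 6 2 isT).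
Definition B3 (K : finType) : tdart K 6 := inr (@Ordinal 6 3 isT).
Definition B2 (K : finType) : tdart K 6 := inr (@Ordinal 6 4 isT).
Definition B1 (K : finType) : tdart K 6 := inr (@Ordinal 6 5 isT).

Definition no_label (k : void) : L := match k with end.
Definition label1 (i : L) (_ : unit) : L := i.
Definition label2 (i j : L) (k : bool) : L := if k then j else i.
Definition label3 (i j k : L) (x : option bool) : L :=
  if x is Some y then label2 i j y else k.

Arguments UL {K p}. Arguments LL {K p}. Arguments LR {K p}. Arguments UR {K p}.
Arguments A1 {K}. Arguments A2 {K}.
Arguments t1 {K}. Arguments t2 {K}. Arguments b1 {K}. Arguments b2 {K}.
Arguments T1 {K}. Arguments T2 {K}. Arguments T3 {K}.
Arguments B1 {K}. Arguments B2 {K}. Arguments B3 {K}.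

(* The cap and the vertical strand are the same tangle with two ends. *)
Definition strand : tangle 2 := @wired void 2 no_label [:: (A1, A2)] [::].

Definition p_capped_above (i : L) : tangle 2 :=
  @wired unit 2 (label1 i) [:: (UL tt, UR tt); (A1, LR tt); (A2, LL tt)] [::].

Definition p_capped_right (i : L) : tangle 2 :=
  @wired unit 2 (label1 i) [:: (UR tt, LR tt); (A1, UL tt); (A2, LL tt)] [::].

Definition p_box (i : L) : tangle 4 :=
  @wired unit 4 (label1 i)
    [:: (t1, UL tt); (t2, UR tt); (b2, LR tt); (b1, LL tt)] [::].

(* Two vertical strands, with the strip between them as common region. *)
Definition two_strands : tangle 4 :=
  @wired void 4 no_label [:: (t1, b1); (t2, b2)] [:: t1; b2].

(* Crossing [false] is p_i, on top of, resp. on the left of, crossing [true]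
   which is p_j. *)
Definition p_stacked (i j : L) : tangle 4 :=
  @wired bool 4 (label2 i j)
    [:: (t1, UL false); (t2, UR false); (LL false, UL true);
        (LR false, UR true); (b2, LR true); (b1, LL true)] [::].

Definition p_beside (i j : L) : tangle 4 :=
  @wired bool 4 (label2 i j)
    [:: (t1, UL false); (b1, LL false); (UR false, UL true);
        (LR false, LL true); (t2, UR true); (b2, LR true)] [::].

(* The crossings of E1, E2, E3 are [false] (upper) and [true] (lower).  In the
   Fourier transform (90 degrees counterclockwise rotation) of a crossing the
   ends UR, UL, LL, LR are respectively upper left, lower left, lower right and
   upper right. *)
Definition E1 (i j : L) : tangle 6 :=
  @wired bool 6 (label2 i j)
    [:: (T1, UL false); (T2, UR false); (B1, LL false);
        (LR false, UR true);
        (T3, LR true); (B3, LL true); (B2, UL true)] [::].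

Definition E2 (s t : L) : tangle 6 :=
  @wired bool 6 (label2 s t)
    [:: (T1, UL false); (T2, UR false); (T3, LR false);
        (LL false, UL true);
        (B3, UR true); (B2, LR true); (B1, LL true)] [::].

Definition E3 (l m : L) : tangle 6 :=
  @wired bool 6 (label2 l m)
    [:: (T2, UR false); (T3, LR false); (B3, LL false);
        (UL false, UR true);
        (T1, UL true); (B2, LR true); (B1, LL true)] [::].

(* The two ways in which an E1-configuration is part of a 3-face: with the
   third crossing, [None], labelled k,
     E1_above i j k = (1 (x) F(p_k)) E1(i,j)    (unshaded 3-face),
     E1_below i j k = E1(i,j) (p_k (x) 1)       (shaded 3-face). *)
Definition E1_above (i j k : L) : tangle 6 :=
  @wired (option bool) 6 (label3 i j k)
    [:: (T1, UL (Some false)); (UL None, UR (Some false));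
        (B1, LL (Some false)); (LR (Some false), UR (Some true));
        (LL None, LR (Some true)); (B3, LL (Some true)); (B2, UL (Some true));
        (T2, UR None); (T3, LR None)] [::].

Definition E1_below (i j k : L) : tangle 6 :=
  @wired (option bool) 6 (label3 i j k)
    [:: (T1, UL (Some false)); (T2, UR (Some false));
        (UL None, LL (Some false)); (LR (Some false), UR (Some true));
        (T3, LR (Some true)); (B3, LL (Some true)); (UR None, UL (Some true));
        (B2, LR None); (B1, LL None)] [::].

End Diagrams.

(* The generators p_0, .., p_n are indexed by 'I_n.+1. *)
Record exchange_data (R : realType) (n : nat) := ExchangeData {
  bar : 'I_n.+1 -> 'I_n.+1;
  barK : involutive bar;
  delta : R[i];
  cap_c : 'I_n.+1 -> R[i];
  cap_d : 'I_n.+1 -> R[i];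
  conv_N : 'I_n.+1 -> 'I_n.+1 -> 'I_n.+1 -> R[i];  (* conv_N k j i = N_(kj)^i *)
  (* ex_a i j s t = a_(st)^(ij) and ex_b i j l m = b_(lm)^(ij) *)
  ex_a : 'I_n.+1 -> 'I_n.+1 -> 'I_n.+1 -> 'I_n.+1 -> R[i];
  ex_b : 'I_n.+1 -> 'I_n.+1 -> 'I_n.+1 -> 'I_n.+1 -> R[i]
}.

(* A formal linear combination is a list of terms, which are not collected. *)
Definition comb (R : realType) (A : Type) := seq (R[i] * A).

Definition comb_bind (R : realType) (A B : Type) (s : comb R A)
    (f : A -> comb R B) : comb R B :=
  flatten [seq [seq (x.1 * y.1, y.2) | y <- f x.2] | x <- s].

Definition comb_map (R : realType) (A B : Type) (f : A -> B) (s : comb R A) :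
  comb R B := [seq (x.1, f x.2) | x <- s].

Definition comb_scale (R : realType) (A : Type) (c : R[i]) (s : comb R A) :
  comb R A := [seq (c * x.1, x.2) | x <- s].

Section Moves.

Variables (R : realType) (n : nat) (P : exchange_data R n).
Local Notation L := 'I_n.+1.
Local Notation zbox := (zero_box (bar P)).
Local Notation tangle := (tangle L).

Definition product (i j : L) : comb R L := [:: ((i == j)%:R, i)].

Definition convolution (k j : L) : comb R L :=
  [seq (conv_N P k j i, i) | i <- enum L].

(* The two kinds of terms on the right hand side of the exchange relation. *)
Inductive exchanged := Ex2 of L & L | Ex3 of L & L.

Definition exchanged_tangle (x : exchanged) : tangle 6 :=
  match x with
  | Ex2 s t => E2 (bar P) s t
  | Ex3 l m => E3 (bar P) l m
  end.

Definition exchange (i j : L) : comb R exchanged :=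
  [seq (ex_a P i j s t, Ex2 s t) | s <- enum L, t <- enum L] ++
  [seq (ex_b P i j l m, Ex3 l m) | l <- enum L, m <- enum L].

(* Evaluation of the 2-face that the third crossing p_k forms with a term of
   the exchange relation.  Above, the face is unshaded:
     (1 (x) F(p_k)) E2(s,t) = E2(p_s * p_k, t),
     (1 (x) F(p_k)) E3(l,m) = E3(p_l * p_k, m).
   Below, it is shaded:
     E2(s,t) (p_k (x) 1) = E2(s, p_t p_k),  E3(l,m) (p_k (x) 1) = E3(l, p_m p_k). *)
Definition two_face_above (k : L) (x : exchanged) : comb R exchanged :=
  match x with
  | Ex2 s t => comb_map (fun r => Ex2 r t) (convolution s k)
  | Ex3 l m => comb_map (fun r => Ex3 r m) (convolution l k)
  end.

Definition two_face_below (k : L) (x : exchanged) : comb R exchanged :=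
  match x with
  | Ex2 s t => comb_map (fun r => Ex2 s r) (product t k)
  | Ex3 l m => comb_map (fun r => Ex3 l r) (product m k)
  end.

(* D is, up to isotopy, the tangle T inside some context; s is obtained by
   putting the terms of r in place of T. *)
Definition replaces p (T : tangle p) (r : comb R (tangle p))
    (D : zbox) (s : comb R zbox) : Prop :=
  exists X : tangle p,
    [/\ injective (@pt _ _ X),
        isotopic (bar P) D (plug X T)
      & List.Forall2 (fun (x : R[i] * tangle p) (y : R[i] * zbox) =>
                   y.1 = x.1 /\ isotopic (bar P) y.2 (plug X x.2)) r s].

(* [move m D s]: Move m replaces D by the linear combination s. *)
Inductive move : nat -> zbox -> comb R zbox -> Prop :=
| Move0 (D E : zbox) (q : option (dart E)) :
    isotopic (bar P) D (add_circle q) -> move 0 D [:: (delta P, E)]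
| Move1_above i D s :
    replaces (p_capped_above (bar P) i) [:: (cap_c P i, strand (bar P))] D s ->
    move 1 D s
| Move1_right i D s :
    replaces (p_capped_right (bar P) i) [:: (cap_d P i, strand (bar P))] D s ->
    move 1 D s
| Move2_shaded i j D s :
    replaces (p_stacked (bar P) i j)
      (comb_map (p_box (bar P)) (product i j)) D s ->
    move 2 D s
| Move2_unshaded k j D s :
    replaces (p_beside (bar P) k j)
      (comb_map (p_box (bar P)) (convolution k j)) D s ->
    move 2 D s
| Move3_unshaded i j k D s :
    replaces (E1_above (bar P) i j k)
      (comb_map exchanged_tangle
         (comb_bind (exchange i j) (two_face_above k))) D s ->
    move 3 D s
| Move3_shaded i j k D s :
    replaces (E1_below (bar P) i j k)
      (comb_map exchanged_tangle
         (comb_bind (exchange i j) (two_face_below k))) D s ->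
    move 3 D s
| Move4 i j D s :
    replaces (E1 (bar P) i j) (comb_map exchanged_tangle (exchange i j)) D s ->
    move 4 D s
| Move5 D s :
    replaces (two_strands (bar P)) [seq (1, p_box (bar P) i) | i <- enum L] D s ->
    move 5 D s.

(* [evaluation_path ms s u]: the successive moves ms, each applied to one term
   of the current linear combination, lead from s to u. *)
Inductive evaluation_path : seq nat -> comb R zbox -> comb R zbox -> Prop :=
| path_nil s : evaluation_path [::] s s
| path_cons m ms s1 c D s2 s u :
    move m D s ->
    evaluation_path ms (s1 ++ comb_scale c s ++ s2) u ->
    evaluation_path (m :: ms) (s1 ++ (c, D) :: s2) u.

Definition canonical (ms : seq nat) := (4 \notin ms) && (5 \notin ms).

(* The empty diagram in a plane shaded by b. *)
Definition is_empty_diagram (b : bool) (E : zbox) :=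
  (#|dart E| == 0)%N && (shade (None : option (dart E)) == b).

(* Along ms, D is reduced to Z times the empty diagram. *)
Definition evaluates_to (ms : seq nat) (D : zbox) (Z : R[i]) : Prop :=
  exists u : comb R zbox,
    [/\ evaluation_path ms [:: (1, D)] u,
        all (fun x => is_empty_diagram (shade (None : option (dart D))) x.2) u
      & Z = \sum_(x <- u) x.1].

End Moves.

(* Main.v *)
Require Import Defs.
From mathcomp Require Import all_boot all_order all_algebra.
From mathcomp Require Import reals complex.
From mathcomp Require Import zify.
From Stdlib Require List Relation_Operators.

Set Implicit Arguments.
Unset Strict Implicit.
Unset Printing Implicit Defensive.

(** A connected diagram is a plane graph whose crossings have valence 4.  With V
crossings it has V + 2 faces by Euler's formula, and the degrees of the faces
add up to 4V, so the sum over the faces of 4 - degree is 8.  Hence there are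
faces with at most three corners; such a face can be evaluated by Move 1, 2 or
3, and this removes a crossing.  The diagrams that result are again connected,
because every tangle on the right-hand side of the relations involved is
connected, and induction on the number of crossings leads to a circle, which
Move 0 removes.

Two points need care ([reducible_face_exists]).  The face to be evaluated has to
lie inside a disc, so it must not be the face that contains the point at
infinity.  And its corners have to belong to distinct crossings.  By the
checkerboard shading a crossing can only meet a face twice at opposite corners;
if it does so in a face of degree at most three, one of the corners between
them is a monogon.  If no inner face is a monogon, that monogon is the outer
face, which contributes at most 3 to the total of 8, and then at most one inner
triangle, the one around the outer monogon, is bad.  The remaining inner faces
contribute at least 4, so one of them is a good triangle or bigon.

The rest is surgery on combinatorial maps.  For a connected nonempty map the
axioms of a diagram amount to local conditions, the equation
4 * faces = crossing darts + 8 and a face marked as the outer one ([plane]); in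
this equation 2-valent vertices do not appear.  Subdividing the edges that leave
a set of crossings and cutting there writes the diagram as a tangle plugged into
its complement ([subdivide_seq], [cut_isotopic], [find_context]).  A face that
enters a connected tangle at one end leaves it at the adjacent end, whatever the
tangle is; therefore the faces that meet the complement depend on the complement
only, and replacing a tangle that has an inner face by a connected one with one
crossing less and no inner face preserves planarity ([plane_replace]). *)

(** * Orbits of a map and of its restriction to a section *)

Section Orbits.

(** The faces of two maps are compared by means of this: [h] embeds the darts of
one map into those of another, [r] sends each remaining dart to the next dart in
the image of [h] on its orbit, so that [f] is in effect the first return map of
[g].  The set [a] leaves room for orbits of [g] that avoid the image of [h]. *)
Lemma fcard_section (S Q : finType) (f : S -> S) (g : Q -> Q) (a : {pred Q})
    (h : S -> Q) (r : Q -> S) :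
    injective f -> injective g -> fclosed g a ->
    (forall x, h x \in a) -> (forall x, r (h x) = x) ->
    (forall x, fconnect g (h x) (h (f x))) ->
    (forall y, y \in a -> fconnect f (r y) (r (g y))) ->
    (forall y, y \in a -> fconnect g y (h (r y))) ->
  (forall x x', fconnect g (h x) (h x') = fconnect f x x') /\
  fcard g a = fcard f S.
Proof.
move=> injf injg cla ha rh hf rg hr.
have up x x' : fconnect f x x' -> fconnect g (h x) (h x').
  case/connectP=> p; elim: p x => [|y p IHp] x /=; first by move=> _ ->.
  by case/andP=> /eqP<- /IHp{}IHp /IHp; apply: connect_trans.
have down y y' : y \in a -> fconnect g y y' -> fconnect f (r y) (r y').
  move=> ay /connectP[p]; elim: p y ay => [|z p IHp] y ay /=; first by move=> _ ->.
  case/andP=> /eqP<- gp e; apply: connect_trans (rg _ ay) (IHp _ _ gp e).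
  by rewrite -(fclosed1 cla).
have conn x x' : fconnect g (h x) (h x') = fconnect f x x'.
  apply/idP/idP => [/(down _ _ (ha x))|]; last exact: up.
  by rewrite !rh.
split=> //; rewrite -[RHS](eq_n_comp_r (a := preim h a)) => [|x]; last first.
  by move: (ha x); rewrite -!topredE /= => ->.
apply: adjunction_n_comp => //; [exact: fconnect_sym | exact: fconnect_sym |].
by split=> [y /hr|x x' _]; [exists (r y) | rewrite conn].
Qed.

End Orbits.

(** * Connected plane diagrams *)

Section PlaneDiagrams.

Variables (L : eqType) (bar : L -> L).
Implicit Types D E : diagram L.

Definition crossing D : pred (dart D) := [pred d | node (node d) != d].

Lemma crossingE D (d : dart D) : crossing d = (node (node d) != d).
Proof. by []. Qed.

(** The local part of the axioms.  That vertices have valence 2 or 4 is expressed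
by equations between darts, which survive surgery more easily than statements
about the orders of orbits. *)
Record shaded_map D : Prop := ShadedMap {
  sm_edgeK : involutive (@edge _ D);
  sm_edge_free : forall d : dart D, edge d != d;
  sm_node4 : forall d : dart D, node (node (node (node d))) = d;
  sm_node_free : forall d : dart D, node d != d;
  sm_labelled : forall d : dart D,
    isSome (lab d) = crossing d && ~~ shade (Some d);
  sm_half_turn : forall d : dart D, lab (node (node d)) = omap bar (lab d);
  sm_shade_face : forall d : dart D, shade (Some (face d)) = shade (Some d);
  sm_shade_edge : forall d : dart D,
    shade (Some (edge d)) = ~~ shade (Some d)
}.

(** The axioms of a nonempty connected diagram.  In Euler's formula a 2-valent
vertex adds one vertex and one edge, so only crossings are left; each of them
has four darts, hence [pl_euler].  As there is one component, the regions are
the faces: [o] marks the face that contains the point at infinity, and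
otherwise ties stay within a face ([pl_frame]). *)
Record plane D (o : dart D) : Prop := Plane {
  pl_map : shaded_map D;
  pl_connected : connected D;
  pl_euler : 4 * faces D = #|@crossing D| + 8;
  pl_outer : neighbour None (Some o);
  pl_frame : forall x y : option (dart D),
    neighbour x y -> fconnect (@face _ D) (odflt o x) (odflt o y);
  pl_shade_outer : shade (None : option (dart D)) = shade (Some o)
}.

Section ShadedMap.

Variable D : diagram L.
Hypothesis M : shaded_map D.
Implicit Types d : dart D.

Lemma edge_inj : injective (@edge _ D).
Proof. exact: inv_inj (sm_edgeK M). Qed.

Lemma node_inj : injective (@node _ D).
Proof. by move=> x y e; rewrite -(sm_node4 M x) e (sm_node4 M). Qed.

Lemma face_inj : injective (@face _ D).
Proof. by move=> x y /edge_inj/node_inj. Qed.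

Lemma face_sym : connect_sym (frel (@face _ D)).
Proof. exact: fconnect_sym face_inj. Qed.

Lemma shade_node d : shade (Some (node d)) = ~~ shade (Some d).
Proof.
by rewrite -(sm_shade_face M d) /face (sm_shade_edge M) negbK.
Qed.

Lemma crossing_node d : crossing (node d) = crossing d.
Proof. by rewrite /crossing /= (inj_eq node_inj). Qed.

Lemma order_node d : order (@node _ D) d = if crossing d then 4 else 2.
Proof.
have d1 := sm_node_free M d.
have d2 := sm_node_free M (node d).
have d3 := sm_node_free M (node (node d)).
case: ifPn => [cd|/negPn/eqP e2].
  apply: (@order_cycle _ _ [:: d; node d; node (node d); node (node (node d))]).
  - by rewrite /= (sm_node4 M) !eqxx.
  - have d4 : node (node (node d)) != d.
      by rewrite -{2}(sm_node4 M d) eq_sym (sm_node_free M).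
    have c1 : node (node d) != d := cd.
    have c2 : node (node (node d)) != node d by rewrite (inj_eq node_inj).
    rewrite /= !inE !negb_or.
    rewrite eq_sym d1 eq_sym c1 eq_sym d4 /= eq_sym d2 eq_sym c2 eq_sym d3 //.
  - by rewrite inE eqxx.
apply: (@order_cycle _ _ [:: d; node d]).
- by rewrite /= e2 !eqxx.
- by rewrite /= inE eq_sym d1.
- by rewrite inE eqxx.
Qed.

(** A dart accounts for 1/4 of a vertex at a crossing and for 1/2 elsewhere. *)
Lemma card_vertices : 4 * vertices D + #|@crossing D| = 2 * #|dart D|.
Proof.
have clo : fclosed (@node _ D) (@crossing D).
  by move=> x _ /eqP<-; apply: esym (crossing_node x).
have clo' := predC_closed clo.
rewrite /vertices (n_compC (@crossing D)) mulnDr.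
have <- : fcard (@node _ D) (@crossing D) * 4 = #|@crossing D|.
  apply: fcard_order_set => //; first exact: node_inj.
  by apply/subsetP=> x cx; rewrite inE order_node ifT.
rewrite -(cardC (@crossing D)) mulnDr.
have <- : fcard (@node _ D) [predC @crossing D] * 2 = #|[predC @crossing D]|.
  apply: fcard_order_set => //; first exact: node_inj.
  by apply/subsetP=> x cx; rewrite inE order_node ifN.
have <- : fcard (@node _ D) (@crossing D) * 4 = #|@crossing D|.
  apply: fcard_order_set => //; first exact: node_inj.
  by apply/subsetP=> x cx; rewrite inE order_node ifT.
lia.
Qed.

Lemma card_edges : 2 * edges D = #|dart D|.
Proof.
rewrite mulnC; apply: fcard_order_set => //; first exact: edge_inj.
apply/subsetP=> d _; rewrite inE; apply/eqP.
apply: (@order_cycle _ _ [:: d; edge d]).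
- by rewrite /= (sm_edgeK M) !eqxx.
- by rewrite /= inE eq_sym (sm_edge_free M).
- by rewrite inE eqxx.
Qed.

End ShadedMap.

Lemma adjacent_sym D : symmetric (@adjacent _ D).
Proof.
by move=> x y; rewrite /adjacent /= orbCA; congr [|| _, _ | _]; rewrite orbC.
Qed.

Lemma neighbour_sym D : symmetric (@neighbour _ D).
Proof.
move=> x y; rewrite /neighbour /= orbCA; congr [|| _, _ | _].
by case: x y => [x|] [y|] //; rewrite orbC.
Qed.

Lemma connected_components D (o : dart D) : connected D -> components D = 1.
Proof.
move=> conn; rewrite -(n_comp_connect (sym_connect_sym (@adjacent_sym D)) o).
by apply: eq_n_comp_r => x; rewrite [RHS]conn.
Qed.

Section PlaneRegions.

Variables (D : diagram L) (o : dart D).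

Lemma face_region (x y : dart D) :
  fconnect (@face _ D) x y -> same_region (Some x) (Some y).
Proof.
rewrite /same_region => /connectP[p].
elim: p x => [|z p IHp] x /=; first by move=> _ ->; apply: connect0.
case/andP=> /eqP<- /IHp{}IHp /IHp; apply: connect_trans; apply: connect1.
by rewrite /neighbour /= eqxx !orbT.
Qed.

Lemma same_region_plane (x y : option (dart D)) : plane o ->
  same_region x y = fconnect (@face _ D) (odflt o x) (odflt o y).
Proof.
move=> pl; rewrite /same_region; apply/idP/idP.
  case/connectP=> p; elim: p x => [|z p IHp] x /=; first by move=> _ ->.
  case/andP=> /(pl_frame pl) xz /IHp{}IHp /IHp; exact: connect_trans.
move/face_region; have nS z : same_region z (Some (odflt o z)).
  by case: z => [z|] //=; [exact: connect0 | apply: connect1 (pl_outer pl)].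
move/(connect_trans (nS x)) => h; apply: connect_trans h _.
by rewrite (sym_connect_sym (@neighbour_sym D)); apply: nS.
Qed.

End PlaneRegions.

Lemma plane_zero_box D (o : dart D) : plane o -> zero_box_axiom bar D.
Proof.
move=> pl; have M := pl_map pl.
have comp1 := connected_components o (pl_connected pl).
have regE : regions D = faces D.
  apply/esym; rewrite /regions /faces.
  rewrite -[LHS](eq_n_comp_r (a := [preim Some of predT])) //.
  apply/esym; apply: (@adjunction_n_comp _ _ (@Some (dart D))) => //.
  - exact: sym_connect_sym (@neighbour_sym D).
  - exact: face_sym M.
  - split=> [[x|] _|x y _].
    + by exists x.
    + by exists o; apply: connect1 (pl_outer pl).
    + by rewrite -/(same_region (Some x) (Some y)) (same_region_plane _ _ pl).
split.
- exact: sm_edgeK.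
- exact: sm_edge_free.
- exact: node_inj.
- by move=> d; rewrite order_node //; case: ifP.
- by move=> d; rewrite (sm_labelled M) order_node //; case: (crossing d).
- exact: sm_half_turn.
- have sh x y : fconnect (@face _ D) x y -> shade (Some x) = shade (Some y).
    apply: (fconnect_invariant (k := fun z => shade (Some z))) => z.
    by apply/eqP; apply: sm_shade_face.
  have shO x : shade x = shade (Some (odflt o x)).
    by case: x => //=; apply: pl_shade_outer.
  by move=> x y /(pl_frame pl)/sh; rewrite -!shO.
- exact: sm_shade_edge.
- have := card_vertices M; have := card_edges M; have := pl_euler pl.
  rewrite comp1; lia.
- by rewrite comp1 regE addnC.
- move=> d; have := connect1 (e := @incident _ D) (x := None) (y := Some o).
  rewrite /incident /= (pl_outer pl : neighbour None (Some o)) => /(_ isT).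
  move=> h; apply: connect_trans h _.
  case/connectP: (pl_connected pl o d) => p; elim: p (o) => [|z p IHp] x /=.
    by move=> _ ->.
  case/andP=> xz /IHp{}IHp /IHp; apply: connect_trans; apply: connect1.
  by rewrite /incident /= [X in _ || X]xz orbT.
Qed.

Lemma zero_box_shaded_map D : zero_box_axiom bar D -> shaded_map D.
Proof.
move=> Z; have injn := zb_node_inj Z.
(* the numerals of the valence axiom are those of the semiring of naturals *)
have val4 (d : dart D) : order (@node _ D) d \in [:: 2; 4] := zb_valence Z d.
have ordE (d : dart D) : iter (order (@node _ D) d) (@node _ D) d = d.
  exact: iter_order.
have node4 (d : dart D) : node (node (node (node d))) = d.
  have := ordE d; have := val4 d.
  by rewrite !inE => /orP[]/eqP-> //= e; rewrite !e.
have node1 (d : dart D) : node d != d.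
  apply: contraTneq (val4 d) => e.
  rewrite (@order_cycle _ _ [:: d]) //= ?inE //.
  by rewrite e eqxx.
have cross (d : dart D) : (order (@node _ D) d == 4) = crossing d.
  have := val4 d; rewrite !inE.
  case/orP=> /eqP e; rewrite e /crossing /=.
    by have := ordE d; rewrite e /= => ->; rewrite eqxx.
  apply/esym/negP => /eqP e2.
  have: order (@node _ D) d <= 2.
    apply: (@order_le_cycle _ _ [:: d; node d]); rewrite ?inE ?eqxx //=.
    by rewrite e2 !eqxx.
  by rewrite e.
split=> //.
- exact: zb_edgeK Z.
- exact: zb_edge_free Z.
- by move=> d; rewrite (zb_labelled Z) -cross.
- exact: zb_half_turn Z.
- move=> d; apply/esym/(zb_shade_region Z).
  by rewrite /neighbour /= eqxx !orbT.
- exact: zb_shade_edge Z.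
Qed.

(** With a single component the tree condition says that there are as many regions
as faces.  Each region contains a face, the one of infinity because the diagram
is nested in it, so the map from faces to regions is a bijection. *)
Lemma zero_box_plane D (d0 : dart D) :
  zero_box_axiom bar D -> connected D -> exists o : dart D, plane o.
Proof.
move=> Z conn; have M := zero_box_shaded_map Z.
have comp1 := connected_components d0 conn.
have regE : regions D = faces D by have := zb_tree Z; rewrite comp1; lia.
have [o nbo] : exists o : dart D, neighbour None (Some o).
  case/connectP: (zb_nested Z d0) => p.
  suff: forall q, path (@incident _ D) None q -> Some d0 = last None q ->
    exists y : dart D, neighbour None (Some y) by apply.
  elim=> [|[y|] q IHq] //= /andP[h hq]; last exact: IHq.
  by move: h; rewrite /incident /= orbF => h _; exists y.
have symn := sym_connect_sym (@neighbour_sym D).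
pose rt (d : dart D) := fingraph.root (@neighbour _ D) (Some d).
have nS z : same_region z (Some (odflt o z)).
  by case: z => [z|] //=; [exact: connect0 | apply: connect1 nbo].
have inj : {in froots (@face _ D) &, injective rt}.
  apply/imset_injP/eqP.
  have -> : #|froots (@face _ D)| = faces D.
    by apply: eq_card => x; rewrite !inE andbT.
  rewrite -regE /regions; apply: eq_card => z; rewrite !inE andbT.
  apply/imsetP/idP => [[x _ ->]|rz]; first exact: fingraph.roots_root.
  exists (froot (@face _ D) (odflt o z)).
    exact: fingraph.roots_root (face_sym M) _.
  rewrite /rt -[LHS](eqP rz); apply/(fingraph.rootP symn).
  by apply: connect_trans (nS z) (face_region _); apply: connect_root.
exists o; split=> //.
- have := zb_euler Z; have := card_vertices M; have := card_edges M; rewrite comp1; lia.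
- move=> x y nxy; rewrite -(fingraph.root_connect (face_sym M)); apply/eqP/inj.
  + exact: fingraph.roots_root (face_sym M) _.
  + exact: fingraph.roots_root (face_sym M) _.
  + apply/(fingraph.rootP symn).
    have sf z : same_region (Some (froot (@face _ D) (odflt o z))) z.
      apply: connect_trans (_ : connect _ _ (Some (odflt o z))) _.
        by rewrite symn; apply: face_region; apply: connect_root.
      by rewrite symn; apply: nS.
    apply: connect_trans (sf x) (connect_trans (connect1 nxy) _).
    by rewrite symn; apply: sf.
- exact: (zb_shade_region Z).
Qed.

End PlaneDiagrams.

(** * Erasing a vertex of valence 2 *)

Section Transfer.

Variables (L : eqType) (bar : L -> L).
Implicit Types D E : diagram L.

Lemma connect_homo (S Q : finType) (e : rel S) (e' : rel Q) (h : S -> Q) :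
    (forall x y, e x y -> connect e' (h x) (h y)) ->
  forall x y, connect e x y -> connect e' (h x) (h y).
Proof.
move=> he x y /connectP[p]; elim: p x => [|z p IHp] x /=; first by move=> _ ->.
by case/andP=> /he xz /IHp{}IHp /IHp; apply: connect_trans.
Qed.

Definition joined D : rel (dart D) := connect (@adjacent _ D).

Lemma joined_sym D : symmetric (@joined D).
Proof. exact: sym_connect_sym (@adjacent_sym _ D). Qed.

Lemma joined_edge D (d : dart D) : joined d (edge d).
Proof. by apply: connect1; rewrite /adjacent /= eqxx. Qed.

Lemma joined_node D (d : dart D) : joined d (node d).
Proof. by apply: connect1; rewrite /adjacent /= eqxx !orbT. Qed.

Lemma joined_homo D E (h : dart D -> dart E) :
    (forall x, joined (h x) (h (edge x))) ->
    (forall x, joined (h x) (h (node x))) ->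
  forall x y, joined x y -> joined (h x) (h y).
Proof.
move=> he hn; apply: connect_homo => x y; rewrite /adjacent /=.
rewrite -/(joined _ _); case/or4P=> /eqP->; try exact: he; try exact: hn.
- by rewrite joined_sym; apply: he.
- by rewrite joined_sym; apply: hn.
Qed.

(** In plane diagrams the part of isotopy that concerns places reduces to faces. *)
Lemma same_places_plane D E (oD : dart D) (oE : dart E) (f : dart E -> dart D) :
    plane bar oD -> plane bar oE ->
    (forall d, shade (Some (f d)) = shade (Some d)) ->
    (forall x y, fconnect (@face _ D) (f x) (f y) = fconnect (@face _ E) x y) ->
    fconnect (@face _ D) oD (f oE) ->
  same_places f.
Proof.
move=> plD plE fs ff fo; have MD := pl_map plD.
have shO : shade (None : option (dart D)) = shade (None : option (dart E)).
  rewrite (pl_shade_outer plD) (pl_shade_outer plE) -fs.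
  apply: (fconnect_invariant (k := fun z => shade (Some z))) fo => z.
  by apply/eqP; apply: sm_shade_face MD _.
split=> [[x|] //|x y]; first exact: fs.
rewrite (same_region_plane _ _ plD) (same_region_plane _ _ plE) -ff.
have ofE z : fconnect (@face _ D) (odflt oD (omap f z)) (f (odflt oE z)).
  by case: z => //=.
by rewrite (same_connect (face_sym MD) (ofE x)) (same_connect_r (face_sym MD) (ofE y)).
Qed.

Section Smoothing.

Variables (D E : diagram L) (f : dart E -> dart D) (u : dart D).
Hypotheses (MD : shaded_map bar D) (ME : shaded_map bar E).
Hypotheses (nnu : node (node u) = u) (eu : edge u != node u).
Hypothesis injf : injective f.
Hypothesis codf : forall d, (d \in codom f) = (d != u) && (d != node u).
Hypothesis fe : forall d, f (edge d) =
  (if edge (f d) == u then edge (node u)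
   else if edge (f d) == node u then edge u
   else edge (f d)).
Hypothesis fn : forall d, node (f d) = f (node d).

(** The two erased darts are sent to the next dart of their face. *)
Lemma smoothing_retraction : exists r : dart D -> dart E,
  [/\ forall x, r (f x) = x, f (r u) = edge (node u)
    & f (r (node u)) = edge u].
Proof.
have nu := sm_node_free MD u.
have [c1 e1] : exists c, edge (node u) = f c.
  apply/codomP; rewrite codf (sm_edge_free MD) andbT.
  by rewrite -(inj_eq (edge_inj MD)) (sm_edgeK MD) eq_sym.
have [c2 e2] : exists c, edge u = f c.
  by apply/codomP; rewrite codf (sm_edge_free MD).
exists (fun x => if x == u then c1 else if x == node u then c2
                 else odflt c1 [pick a | f a == x]).
split=> [x||]; rewrite ?eqxx //; last by rewrite (negbTE nu).
have := codf (f x); rewrite codom_f => /esym/andP[/negbTE-> /negbTE->].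
by case: pickP => [a /eqP/injf//|/(_ x)]; rewrite eqxx.
Qed.

Lemma smoothing_dartP (d : dart D) :
  [\/ d = u, d = node u | exists x, d = f x].
Proof.
have [->|du] := eqVneq d u; first by constructor 1.
have [->|dnu] := eqVneq d (node u); first by constructor 2.
by constructor 3; apply/codomP; rewrite codf du dnu.
Qed.

Lemma smoothing_faces :
  (forall x y, fconnect (@face _ D) (f x) (f y) = fconnect (@face _ E) x y) /\
  faces D = faces E.
Proof.
have [r [rf ru rnu]] := smoothing_retraction.
have nu := sm_node_free MD u.
have faceu : face u = f (r u) by rewrite ru.
have facenu : face (node u) = f (r (node u)) by rewrite rnu /face nnu.
have ff x : f (face x) = if face (f x) == u then f (r u)
    else if face (f x) == node u then f (r (node u)) else face (f x).
  by rewrite ru rnu /face fe fn.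
apply: (@fcard_section _ _ _ _ (dart D) f r) => //.
- exact: face_inj ME.
- exact: face_inj MD.
- move=> x; rewrite ff; case: eqP => [e1|_].
    apply: connect_trans (fconnect1 _ _) _.
    by rewrite e1 -faceu fconnect1.
  case: eqP => [e2|_]; last exact: fconnect1.
  apply: connect_trans (fconnect1 _ _) _.
  by rewrite e2 -facenu fconnect1.
- move=> y _; case: (smoothing_dartP y) => [->|->|[x ->]].
  + by rewrite faceu rf.
  + by rewrite facenu rf.
  + rewrite rf; have := ff x; case: eqP => [-> /injf <-|_]; first exact: fconnect1.
    case: eqP => [-> /injf <-|_ <-]; first exact: fconnect1.
    by rewrite rf fconnect1.
- move=> y _; case: (smoothing_dartP y) => [->|->|[x ->]].
  + by rewrite -faceu fconnect1.
  + by rewrite -facenu fconnect1.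
  + by rewrite rf.
Qed.

Lemma smoothing_joined (x y : dart E) : joined (f x) (f y) = joined x y.
Proof.
have [r [rf ru rnu]] := smoothing_retraction.
apply/idP/idP; last first.
  apply: joined_homo => {x y} x; last by rewrite -fn joined_node.
  have jx := joined_edge (f x); rewrite fe; case: eqP => [e|_].
    rewrite e in jx; apply: connect_trans jx _.
    exact: connect_trans (joined_node _) (joined_edge _).
  case: eqP => [e|_] //; rewrite e in jx; apply: connect_trans jx _.
  apply: connect_trans (joined_edge u).
  by rewrite -/(joined _ _) joined_sym joined_node.
move=> h; rewrite -(rf x) -(rf y); move: h.
have ef : edge (r u) = r (node u).
  apply: injf; rewrite fe ru (sm_edgeK MD) rnu eqxx.
  by rewrite (negbTE (sm_node_free MD u)).
apply: joined_homo => {x y} x; case: (smoothing_dartP x) => [->|->|[z ->]].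
- by rewrite -rnu rf -ef joined_edge.
- by rewrite -ru rf joined_sym -ef joined_edge.
- rewrite rf; have := fe z; case: eqP => [-> |_].
    by rewrite -ru => /injf<-; rewrite joined_edge.
  case: eqP => [->|_ <-]; first by rewrite -rnu => /injf<-; rewrite joined_edge.
  by rewrite rf joined_edge.
- by rewrite -ef joined_edge.
- by rewrite nnu joined_sym -ef joined_edge.
- by rewrite fn !rf joined_node.
Qed.

Lemma smoothing_connected : connected D <-> connected E.
Proof.
have [r [rf ru rnu]] := smoothing_retraction.
have jr (x : dart D) : joined x (f (r x)).
  case: (smoothing_dartP x) => [->|->|[z ->]]; last by rewrite rf; apply: connect0.
    by rewrite ru; apply: connect_trans (joined_node _) (joined_edge _).
  rewrite rnu; apply: connect_trans (joined_edge u).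
  by rewrite -/(joined _ _) joined_sym joined_node.
split=> conn x y; first by rewrite -/(joined x y) -smoothing_joined; apply: conn.
apply: connect_trans (jr x) _; apply: connect_trans (_ : joined _ (f (r y))) _.
  by rewrite smoothing_joined; apply: conn.
by rewrite -/(joined _ _) joined_sym.
Qed.

Lemma smoothing_crossings : #|@crossing _ D| = #|@crossing _ E|.
Proof.
rewrite -(card_image injf); apply: eq_card => d; apply/idP/imageP.
  move=> cd; case: (smoothing_dartP d) => [e|e|[x e]].
  - by move: cd; rewrite e unfold_in /crossing /= nnu eqxx.
  - by move: cd; rewrite e unfold_in /crossing /= nnu eqxx.
  - exists x => //; move: cd; rewrite e !unfold_in /crossing /= !fn.
    by rewrite (inj_eq injf).
by case=> x cx ->; move: cx; rewrite !unfold_in /crossing /= !fn (inj_eq injf).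
Qed.

End Smoothing.

End Transfer.

(** * Isotopies: normal form and subdivision *)

Section Isotopy.

Variables (L : eqType) (bar : L -> L).
Implicit Types D E : diagram L.

Lemma isotopy_step_invariants D E : isotopy_step bar D E ->
  #|@crossing _ D| = #|@crossing _ E| /\
  shade (None : option (dart D)) = shade (None : option (dart E)).
Proof.
case=> ZD ZE; have MD := zero_box_shaded_map ZD; have ME := zero_box_shaded_map ZE.
case=> [[f [bijf fe fn fl [fs fr]]]
  |[f [u [[nnu nu eu] [injf codf] fe [fn fl] [fs fr]]]]].
  split; last by have := fs None.
  rewrite -(card_image (bij_inj bijf)); apply: eq_card => d.
  have [g gK fK] := bijf; rewrite -(fK d) (mem_image (bij_inj bijf)).
  by rewrite !unfold_in /crossing /= !fn (inj_eq (bij_inj bijf)).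
split; last by have := fs None.
exact: smoothing_crossings nnu injf codf fn.
Qed.

(** The number of crossings is what the induction runs on; the shading of the
unbounded region has to be that of the final empty diagram. *)
Lemma isotopic_invariants D E : isotopic bar D E ->
  #|@crossing _ D| = #|@crossing _ E| /\
  shade (None : option (dart D)) = shade (None : option (dart E)).
Proof.
elim=> {D E} [D E|D|D E _ [-> ->]|D1 D2 D3 _ [-> ->] _ [-> ->]] //.
exact: isotopy_step_invariants.
Qed.

Lemma isotopic_sym D E : isotopic bar D E -> isotopic bar E D.
Proof. exact: Relation_Operators.rst_sym. Qed.

Lemma isotopic_trans D1 D2 D3 :
  isotopic bar D1 D2 -> isotopic bar D2 D3 -> isotopic bar D1 D3.
Proof. exact: Relation_Operators.rst_trans. Qed.

(** The ties that only record in which face the point at infinity lies. *)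
Definition tie_outside (T : finType) (a : pred T) : rel (option T) :=
  fun x y => if x is None then (if y is Some b then a b else false) else false.

Lemma plane_tie_outside D (o : dart D) (a : pred (dart D)) :
    @tie _ D =2 tie_outside a -> a o ->
    (forall b, a b -> fconnect (@face _ D) o b) ->
    shaded_map bar D -> connected D ->
    4 * faces D = #|@crossing _ D| + 8 ->
    shade (None : option (dart D)) = shade (Some o) ->
  plane bar o.
Proof.
move=> tieE ao af M conn eul sh; split=> //.
  by rewrite /neighbour /= tieE /= ao.
move=> [x|] [y|]; rewrite /neighbour /= !tieE //= ?orbF ?orFb.
- case/orP=> /eqP->; first exact: fconnect1.
  by rewrite (face_sym M) fconnect1.
- by rewrite (face_sym M); apply: af.
- exact: af.
Qed.

Lemma smoothing_isotopic D E (oD : dart D) (oE : dart E) (f : dart E -> dart D)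
    (u : dart D) :
    plane bar oD -> plane bar oE ->
    node (node u) = u -> edge u != node u -> injective f ->
    (forall d, (d \in codom f) = (d != u) && (d != node u)) ->
    (forall d, f (edge d) =
      (if edge (f d) == u then edge (node u)
       else if edge (f d) == node u then edge u
       else edge (f d))) ->
    (forall d, node (f d) = f (node d)) ->
    (forall d, lab (f d) = lab d) ->
    (forall d, shade (Some (f d)) = shade (Some d)) ->
    fconnect (@face _ D) oD (f oE) ->
  isotopic bar D E.
Proof.
move=> plD plE nnu eu injf codf fe fn fl fs fo.
have MD := pl_map plD; have ME := pl_map plE.
apply: Relation_Operators.rst_step.
split; [exact: plane_zero_box plD | exact: plane_zero_box plE | right].
exists f, u; split=> //; first by split=> //; apply: sm_node_free MD u.
apply: same_places_plane plD plE fs _ fo.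
exact: (smoothing_faces MD ME nnu eu injf codf fe fn).1.
Qed.

Section Erase.

Variables (D : diagram L) (o : dart D) (u : dart D).
Hypothesis pl : plane bar o.
Hypotheses (nnu : node (node u) = u) (eu : edge u != node u).

Definition erased_dart := {d : dart D | (d != u) && (d != node u)}.

Definition erased_edge (d : dart D) : dart D :=
  if edge d == u then edge (node u)
  else if edge d == node u then edge u else edge d.

Definition erased : diagram L :=
  @Diagram L erased_dart
    (fun x => insubd x (erased_edge (val x)))
    (fun x => insubd x (node (val x)))
    (fun x => lab (val x))
    (fun x => shade (omap val x))
    (tie_outside (fun x => fconnect (@face _ D) o (val x))).

Lemma val_erased_edge (x : dart erased) : val (edge x) = erased_edge (val x).
Proof.
have M := pl_map pl; have nu := sm_node_free M u.
rewrite val_insubd ifT //; case: x => x /= /andP[xu xnu]; rewrite /erased_edge.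
case: (eqVneq (edge x) u) => [e|e]; last case: (eqVneq (edge x) (node u)) => [e'|e'].
- rewrite /= (sm_edge_free M) andbT.
  by rewrite -(inj_eq (edge_inj M)) (sm_edgeK M) eq_sym.
- by rewrite /= (sm_edge_free M).
- by rewrite /= e e'.
Qed.

Lemma val_erased_node (x : dart erased) : val (node x) = node (val x).
Proof.
have M := pl_map pl; rewrite val_insubd ifT //; case: x => x /= /andP[xu xnu].
by rewrite (inj_eq (node_inj M)) xu -{1}nnu (inj_eq (node_inj M)) xnu.
Qed.

Lemma erased_codom (d : dart D) :
  (d \in codom (val : dart erased -> dart D)) = (d != u) && (d != node u).
Proof.
apply/codomP/idP => [[x ->]|du]; first exact: (valP x).
by exists (exist _ d du).
Qed.

Lemma erased_shaded_map : shaded_map bar erased.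
Proof.
have M := pl_map pl; have eK := sm_edgeK M; have nu := sm_node_free M u.
have enu : edge (node u) != u.
  by rewrite -(inj_eq (edge_inj M)) eK eq_sym.
have shu : shade (Some (edge (node u))) = shade (Some u).
  exact: sm_shade_face M u.
have shnu : shade (Some (edge u)) = shade (Some (node u)).
  by rewrite -(sm_shade_face M (node u)) /face nnu.
have she (x : dart erased) : shade (Some (edge x)) = ~~ shade (Some x).
  rewrite /= val_erased_edge; case: x => x xu /=; rewrite /erased_edge.
  case: eqP => [e|_]; last case: eqP => [e|_].
  - by rewrite shu -(sm_shade_edge M) e.
  - by rewrite shnu -(sm_shade_edge M) e.
  - exact: sm_shade_edge M x.
split=> //.
- move=> x; apply: val_inj; rewrite !val_erased_edge.
  case: x => x /= /andP[xu xnu]; rewrite /erased_edge.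
  case: (eqVneq (edge x) u) => [e|e]; last case: (eqVneq (edge x) (node u)) => [e'|e'].
  + by rewrite eK (negbTE nu) eqxx -e eK.
  + by rewrite eK eqxx -e' eK.
  + by rewrite eK (negbTE xu) (negbTE xnu).
- move=> x; rewrite -val_eqE /= val_erased_edge.
  case: x => x /= /andP[xu xnu]; rewrite /erased_edge.
  case: (eqVneq (edge x) u) => [e|_]; last case: (eqVneq (edge x) (node u)) => [e|_].
  + by apply: contraNneq nu => e'; rewrite -(eK (node u)) e' e.
  + by apply: contraNneq nu => e'; rewrite -e -e' eK.
  + exact: sm_edge_free M x.
- by move=> x; apply: val_inj; rewrite !val_erased_node (sm_node4 M).
- by move=> x; rewrite -val_eqE /= val_erased_node (sm_node_free M).
- move=> x; rewrite /crossing /= -val_eqE /= !val_erased_node.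
  exact: sm_labelled M _.
- by move=> x; rewrite /= !val_erased_node (sm_half_turn M).
- move=> x; rewrite /face she /= val_erased_node (shade_node M) negbK //.
Qed.

(** If [o] itself is erased, the next dart of its face is not, because
[edge u != node u]. *)
Lemma outer_dart_erased :
  exists2 o' : dart erased, fconnect (@face _ D) o (val o') &
    shade (Some o) = shade (Some (val o')).
Proof.
have M := pl_map pl; have nu := sm_node_free M u.
have eu' : edge (node u) != u.
  by rewrite -(inj_eq (edge_inj M)) (sm_edgeK M) eq_sym.
have [oo|] := boolP ((o != u) && (o != node u)).
  by exists (exist _ o oo).
rewrite negb_and !negbK => ou.
have fo : (face o != u) && (face o != node u).
  case/orP: ou => /eqP->; first by rewrite /face eu' (sm_edge_free M).
  by rewrite /face nnu (sm_edge_free M) eu.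
by exists (exist _ (face o) fo); rewrite /= ?fconnect1 ?(sm_shade_face M).
Qed.

Lemma erase : exists E (o' : dart E),
  [/\ plane bar o', isotopic bar D E & #|dart E| < #|dart D|].
Proof.
have M := pl_map pl; have ME := erased_shaded_map.
have [o' fo so] := outer_dart_erased.
pose f : dart erased -> dart D := val.
have injf : injective f by apply: val_inj.
have fn (x : dart erased) : node (f x) = f (node x) by rewrite /f val_erased_node.
have fe (x : dart erased) : f (edge x) = (if edge (f x) == u then edge (node u)
   else if edge (f x) == node u then edge u else edge (f x)).
  exact: val_erased_edge.
have [ff fF] := smoothing_faces M ME nnu eu injf erased_codom fe fn.
have plE : plane bar o'.
  apply: (@plane_tie_outside erased o' (fun x => fconnect (@face _ D) o (val x))) => //.
  - by move=> b; rewrite -ff -(same_connect (face_sym M) fo).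
  - apply: iffLR (pl_connected pl).
    exact: (smoothing_connected M nnu eu injf erased_codom fe fn).
  - rewrite -fF (pl_euler pl); congr (_ + 8).
    exact: (smoothing_crossings nnu injf erased_codom fn).
  - by rewrite /= (pl_shade_outer pl) so.
exists erased, o'; split=> //.
  exact: (smoothing_isotopic pl plE nnu eu injf erased_codom fe fn).
rewrite /= card_sig [leqRHS](cardD1 u) ltnS.
by apply: subset_leq_card; apply/subsetP=> x; rewrite !inE => /andP[->].
Qed.

End Erase.

(** The vertices of valence 2 that remain are those of closed circles. *)
Lemma normalize D (o : dart D) : plane bar o ->
  exists E (o' : dart E), [/\ plane bar o', isotopic bar D E &
    forall u : dart E, node (node u) = u -> edge u = node u].
Proof.
have [m] := ubnP #|dart D|; elim: m D o => // m IHm D o ltD pl.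
have [/existsP[u /andP[/eqP nnu eu]]|no] :=
  boolP [exists u : dart D, (node (node u) == u) && (edge u != node u)].
  have [E [o' [plE iso ltE]]] := erase pl nnu eu.
  have [F [o'' [plF isoF nF]]] := IHm E o' (leq_trans ltE ltD) plE.
  by exists F, o''; split=> //; apply: isotopic_trans iso isoF.
exists D, o; split=> //; first exact: Relation_Operators.rst_refl.
move=> u nnu; apply/eqP; apply: contraNT no => eu.
by apply/existsP; exists u; rewrite nnu eqxx.
Qed.

Section Subdivide.

Variables (D : diagram L) (o d0 : dart D).
Hypothesis pl : plane bar o.

(** The new vertex is {[inr true], [inr false]}, and [inr true] is the new other end
of the edge that leaves along [d0]. *)
Definition subdivided_edge (x : dart D + bool) : dart D + bool :=
  match x with
  | inl d => if d == d0 then inr true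
             else if d == edge d0 then inr false else inl (edge d)
  | inr true => inl d0
  | inr false => inl (edge d0)
  end.

Definition subdivided : diagram L :=
  @Diagram L (dart D + bool)%type
    subdivided_edge
    (fun x => match x with inl d => inl (node d) | inr b => inr (~~ b) end)
    (fun x => match x with inl d => lab d | inr _ => None end)
    (fun x => match x with
              | None => shade (None : option (dart D))
              | Some (inl d) => shade (Some d)
              | Some (inr b) => if b then ~~ shade (Some d0) else shade (Some d0)
              end)
    (tie_outside (fun x => if x is inl d then fconnect (@face _ D) o d else false)).

Lemma subdivided_shaded_map : shaded_map bar subdivided.
Proof.
have M := pl_map pl; have eK := sm_edgeK M; have ef := sm_edge_free M d0.
have she (x : dart subdivided) : shade (Some (edge x)) = ~~ shade (Some x).
  case: x => [d|[]] /=; [|by rewrite negbK|exact: sm_shade_edge M d0].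
  case: eqP => [->|_] //; case: eqP => [->|_]; last exact: sm_shade_edge M d.
  by rewrite (sm_shade_edge M) negbK.
split=> //.
- case=> [d|[]] /=; rewrite ?eqxx ?(negbTE ef) //.
  case: (eqVneq d d0) => [->|dd] //; case: (eqVneq d (edge d0)) => [->|de] //=.
  rewrite (inv_eq eK) (negbTE de) (inj_eq (edge_inj M)) (negbTE dd).
  by rewrite eK.
- case=> [d|[]] //=; case: (eqVneq d d0) => // _.
  case: (eqVneq d (edge d0)) => // _.
  exact: sm_edge_free M d.
- by case=> [d|[]] //=; rewrite (sm_node4 M).
- by case=> [d|[]] //=; exact: sm_node_free M d.
- case=> [d|[]] //=; exact: sm_labelled M d.
- case=> [d|[]] //=; exact: sm_half_turn M d.
- move=> x; rewrite /face she; case: x => [d|[]] /=; rewrite ?negbK //.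
  by rewrite (shade_node M) negbK.
Qed.

Lemma subdivide : plane bar (inl o : dart subdivided) /\ isotopic bar subdivided D.
Proof.
have M := pl_map pl; have ME := subdivided_shaded_map; have eK := sm_edgeK M.
pose f := @inl (dart D) bool : dart D -> dart subdivided.
pose u : dart subdivided := inr true.
have nnu : node (node u) = u by [].
have eu : edge u != node u by [].
have injf : injective f by move=> x y [].
have codf (d : dart subdivided) : (d \in codom f) = (d != u) && (d != node u).
  case: d => [d|b]; first by apply/codomP; exists d.
  by apply/codomP/idP => [[]|] //; case: b.
have fe d : f (edge d) = (if edge (f d) == u then edge (node u)
   else if edge (f d) == node u then edge u
   else edge (f d)).
  rewrite /f /=; case: (eqVneq d d0) => [->|_] //=.
  by case: (eqVneq d (edge d0)) => [->|_] //=; rewrite eK.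
have fn d : node (f d) = f (node d) by [].
have [ff fF] := smoothing_faces ME M nnu eu injf codf fe fn.
have plE : plane bar (inl o : dart subdivided).
  apply: (@plane_tie_outside subdivided (inl o)
    (fun x => if x is inl d then fconnect (@face _ D) o d else false)) => //=.
  - by move=> [b|//]; rewrite -ff.
  - apply: iffRL (pl_connected pl).
    exact: (smoothing_connected ME nnu eu injf codf fe fn).
  - rewrite fF (pl_euler pl); congr (_ + 8); apply/esym.
    exact: (smoothing_crossings nnu injf codf fn).
  - exact: pl_shade_outer pl.
split=> //.
exact: (smoothing_isotopic plE pl nnu eu injf codf fe fn).
Qed.

End Subdivide.

End Isotopy.

(** * Plugging a tangle *)

Section Wiring.

Variables (K : finType) (p : nat) (w : seq (tdart K p * tdart K p)).

Definition tangle_shade (y : tdart K p) : bool :=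
  match y with inl (k, r) => odd r | inr i => ~~ odd i end.

(** Inside a tangle, the face on the left of a dart is followed by [inward], which
stops at the ends. *)
Definition inward (y : tdart K p) : tdart K p :=
  if y is inl (k, r) then mate w (inl (k, ordS r)) else y.

(** The end at which that face leaves the tangle, or [None] if it is an inner face.
Four steps suffice: no face of the tangles considered has more than three
corners inside. *)
Definition exit (y : tdart K p) : option 'I_p :=
  if iter 4 inward y is inr j then Some j else None.

(** The last condition holds for connected tangles in a disc: a face that enters at
an end leaves at the end before it.  It makes the faces of a plugged tangle
independent of the tangle. *)
Definition wiring_ok (y : tdart K p) : bool :=
  [&& mate w (mate w y) == y, mate w y != y,
      tangle_shade (mate w y) == ~~ tangle_shade y, exit (inward y) == exit y
    & if y is inr i then exit (mate w y) == Some (ord_pred i) else true].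

Hypothesis ok : forall y, wiring_ok y.

Lemma wiring_mateK : involutive (mate w).
Proof. by move=> y; case/and5P: (ok y) => /eqP. Qed.

Lemma wiring_mate_free y : mate w y != y.
Proof. by case/and5P: (ok y). Qed.

Lemma wiring_shade y : tangle_shade (mate w y) = ~~ tangle_shade y.
Proof. by case/and5P: (ok y) => _ _ /eqP. Qed.

Lemma exit_inward y : exit (inward y) = exit y.
Proof. by case/and5P: (ok y) => _ _ _ /eqP. Qed.

Lemma exit_mate i : exit (mate w (inr i)) = Some (ord_pred i).
Proof. by case/and5P: (ok (inr i)) => _ _ _ _ /eqP. Qed.

End Wiring.

Lemma odd_ordS (r : 'I_4) : odd (ordS r) = ~~ odd r.
Proof. by case: r => [[|[|[|[|r]]]] i]. Qed.

Lemma ordS4 (r : 'I_4) : ordS (ordS (ordS (ordS r))) = r.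
Proof. by apply/val_inj; case: r => [[|[|[|[|r]]]] i]. Qed.

Lemma ordS1_neq (r : 'I_4) : ordS r != r.
Proof. by case: r => [[|[|[|[|r]]]] i]. Qed.

Lemma ordS2_neq (r : 'I_4) : ordS (ordS r) != r.
Proof. by case: r => [[|[|[|[|r]]]] i]. Qed.

Section Plug.

Variables (L : eqType) (bar : L -> L).
Hypothesis barK : involutive bar.

(** What the complement of a disc satisfies, whatever is plugged into it. *)
Record outside p (X : tangle L p) : Prop := Outside {
  out_pt_inj : injective (@pt _ _ X);
  out_edgeK : involutive (@edge _ X);
  out_edge_free : forall x : dart X, edge x != x;
  out_node : forall x, x \notin codom (@pt _ _ X) ->
    node x \notin codom (@pt _ _ X);
  out_node4 : forall x, x \notin codom (@pt _ _ X) ->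
    node (node (node (node x))) = x;
  out_node_free : forall x, x \notin codom (@pt _ _ X) -> node x != x;
  out_labelled : forall x, x \notin codom (@pt _ _ X) ->
    isSome (lab x) = (node (node x) != x) && ~~ shade (Some x);
  out_half_turn : forall x, x \notin codom (@pt _ _ X) ->
    lab (node (node x)) = omap bar (lab x);
  out_lab_pt : forall i, lab (pt X i) = None;
  out_shade_face : forall x, x \notin codom (@pt _ _ X) ->
    shade (Some (edge (node x))) = shade (Some x);
  out_shade_edge : forall x : dart X, shade (Some (edge x)) = ~~ shade (Some x);
  out_shade_pt : forall i, shade (Some (pt X i)) = odd i
}.

Section Node.

Variables (p : nat) (X T : tangle L p).
Hypotheses (injX : injective (@pt _ _ X)) (injT : injective (@pt _ _ T)).

Lemma pick_pt (Y : tangle L p) i : injective (@pt _ _ Y) ->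
  [pick j | pt Y j == pt Y i] = Some i.
Proof. by move=> inj; case: pickP => [j /eqP/inj->|/(_ i)]; rewrite ?eqxx. Qed.

Lemma pick_not_pt (Y : tangle L p) x : x \notin codom (@pt _ _ Y) ->
  [pick j | pt Y j == x] = None.
Proof.
by move=> nx; case: pickP => // j /eqP e; rewrite -e codom_f in nx.
Qed.

Lemma plug_node_pt i : node (inl (pt X i) : dart (plug X T)) = inr (pt T i).
Proof. by rewrite /= pick_pt. Qed.

Lemma plug_node_hole i : node (inr (pt T i) : dart (plug X T)) = inl (pt X i).
Proof. by rewrite /= pick_pt. Qed.

Lemma plug_node_outside x : x \notin codom (@pt _ _ X) ->
  node (inl x : dart (plug X T)) = inl (node x).
Proof. by move=> nx; rewrite /= pick_not_pt. Qed.

Lemma plug_node_inside y : y \notin codom (@pt _ _ T) ->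
  node (inr y : dart (plug X T)) = inr (node y).
Proof. by move=> ny; rewrite /= pick_not_pt. Qed.

End Node.

Section PlugWired.

Variables (p : nat) (X : tangle L p) (K : finType) (l : K -> L).
Variable w : seq (tdart K p * tdart K p).
Hypotheses (ok : forall y, wiring_ok w y) (outX : outside X).

Let T := wired bar l w [::].
Let D := plug X T.

Lemma wired_pt_inj : injective (@pt _ _ T).
Proof. by move=> i j []. Qed.

Lemma wired_not_pt kr : (inl kr : dart T) \notin codom (@pt _ _ T).
Proof. by apply/codomP => -[]. Qed.

Lemma plugP (Q : dart D -> Prop) :
    (forall i, Q (inl (pt X i))) ->
    (forall x, x \notin codom (@pt _ _ X) -> Q (inl x)) ->
    (forall i, Q (inr (inr i))) ->
    (forall k r, Q (inr (inl (k, r)))) ->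
  forall d, Q d.
Proof.
move=> Q1 Q2 Q3 Q4 [x|[[k r]|i]] //.
have [/codomP[i ->]|] := boolP (x \in codom (@pt _ _ X)); [exact: Q1|exact: Q2].
Qed.

Lemma node_pt i : node (inl (pt X i) : dart D) = inr (inr i).
Proof. exact: plug_node_pt (out_pt_inj outX) i. Qed.

Lemma node_outside x : x \notin codom (@pt _ _ X) ->
  node (inl x : dart D) = inl (node x).
Proof. exact: plug_node_outside. Qed.

Lemma node_hole i : node (inr (inr i) : dart D) = inl (pt X i).
Proof. exact: (@plug_node_hole _ X T wired_pt_inj i). Qed.

Lemma node_crossing k r :
  node (inr (inl (k, r)) : dart D) = inr (inl (k, ordS r)).
Proof. by rewrite plug_node_inside ?wired_not_pt. Qed.

Lemma plug_shaded_map : shaded_map bar D.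
Proof.
have she (x : dart D) : shade (Some (edge x)) = ~~ shade (Some x).
  by case: x => [x|y]; [exact: out_shade_edge | exact: wiring_shade].
split=> //.
- case=> [x|y] /=; first by rewrite (out_edgeK outX).
  by rewrite wiring_mateK.
- case=> [x|y]; first exact: out_edge_free.
  exact: wiring_mate_free.
- apply: plugP => [i|x nx|i|k r].
  + by rewrite !(node_pt, node_hole).
  + by rewrite !node_outside ?(out_node outX) // (out_node4 outX).
  + by rewrite !(node_pt, node_hole).
  + by rewrite !node_crossing ordS4.
- apply: plugP => [i|x nx|i|k r].
  + by rewrite node_pt.
  + by rewrite node_outside //; exact: out_node_free.
  + by rewrite node_hole.
  + rewrite node_crossing; apply: contraNneq (ordS1_neq r) => -[] /(congr1 val) e.
    exact/eqP/val_inj.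
- apply: plugP => [i|x nx|i|k r]; rewrite crossingE.
  + by rewrite node_pt node_hole eqxx; rewrite /= (out_lab_pt outX).
  + rewrite !node_outside ?(out_node outX) //; exact: out_labelled.
  + by rewrite node_hole node_pt eqxx.
  + rewrite !node_crossing.
    have -> : inr (inl (k, ordS (ordS r))) != inr (inl (k, r)) :> dart D.
      apply: contraNneq (ordS2_neq r) => -[] /(congr1 val) e.
      exact/eqP/val_inj.
    by case: r => [[|[|[|[|r]]]] i].
- apply: plugP => [i|x nx|i|k r].
  + by rewrite node_pt node_hole /= (out_lab_pt outX).
  + by rewrite !node_outside ?(out_node outX) //=; exact: out_half_turn.
  + by rewrite node_hole node_pt.
  + by rewrite !node_crossing /=; case: r => [[|[|[|[|r]]]] i] //=; rewrite barK.
- move=> x; rewrite /face she; move: x; apply: plugP => [i|x nx|i|k r].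
  + by rewrite node_pt /= (out_shade_pt outX) negbK.
  + rewrite node_outside //= -(out_shade_edge outX); exact: out_shade_face.
  + by rewrite node_hole /= (out_shade_pt outX).
  + by rewrite node_crossing /= odd_ordS negbK.
Qed.

(** The first return to the outside of the faces of [D]: a face that enters the hole
at end [i] comes out at the previous end.  The tangle does not occur in it. *)
Definition around (x : dart X) : dart X :=
  edge (if [pick i | pt X i == x] is Some i then pt X (ord_pred i) else node x).

Lemma around_pt i : around (pt X i) = edge (pt X (ord_pred i)).
Proof. by rewrite /around pick_pt //; apply: out_pt_inj. Qed.

Lemma around_outside x : x \notin codom (@pt _ _ X) -> around x = edge (node x).
Proof. by move=> nx; rewrite /around pick_not_pt. Qed.

Lemma around_inj : injective around.
Proof.
have nodeI x y : x \notin codom (@pt _ _ X) -> y \notin codom (@pt _ _ X) ->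
    node x = node y -> x = y.
  by move=> nx ny e; rewrite -(out_node4 outX nx) e (out_node4 outX ny).
move=> x y; have einj := inv_inj (out_edgeK outX).
have [/codomP[i ->]|nx] := boolP (x \in codom (@pt _ _ X));
have [/codomP[j ->]|ny] := boolP (y \in codom (@pt _ _ X));
rewrite ?around_pt ?around_outside // => /einj.
- by move/(out_pt_inj outX)/(can_inj (@ord_predK _)) ->.
- by move=> e; move: (out_node outX ny); rewrite -e codom_f.
- by move=> e; move: (out_node outX nx); rewrite e codom_f.
- exact: nodeI.
Qed.

Lemma face_pt i : face (inl (pt X i) : dart D) = inr (mate w (inr i)).
Proof. by rewrite /face node_pt. Qed.

Lemma face_outside x : x \notin codom (@pt _ _ X) ->
  face (inl x : dart D) = inl (around x).
Proof. by move=> nx; rewrite /face node_outside // around_outside. Qed.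

Lemma face_hole i : face (inr (inr i) : dart D) = inl (edge (pt X i)).
Proof. by rewrite /face node_hole. Qed.

Lemma face_crossing k r :
  face (inr (inl (k, r)) : dart D) = inr (inward w (inl (k, r))).
Proof. by rewrite /face node_crossing. Qed.

Lemma face_inward y n : fconnect (@face _ D) (inr y) (inr (iter n (inward w) y)).
Proof.
elim: n => [|n IHn]; first exact: connect0.
rewrite iterS; apply: connect_trans IHn _; case: (iter n _ y) => [[k r]|i].
  by rewrite -face_crossing fconnect1.
exact: connect0.
Qed.

Lemma face_exit y j : exit w y = Some j ->
  fconnect (@face _ D) (inr y) (inl (edge (pt X j))).
Proof.
rewrite /exit => ey; apply: connect_trans (face_inward y 4) _.
by case: (iter 4 _ y) ey => [|i [->]] //; rewrite -face_hole fconnect1.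
Qed.

Definition boundary_dart : pred (dart D) :=
  fun d => if d is inr y then exit w y != None else true.

Lemma boundary_inside y : (inr y \in boundary_dart) = (exit w y != None).
Proof. by []. Qed.

Lemma boundary_closed : fclosed (@face _ D) boundary_dart.
Proof.
apply: intro_closed; first exact: face_sym plug_shaded_map.
move=> x _ /eqP<-; move: x.
apply: plugP => [i|x nx|i|k r].
- by rewrite face_pt boundary_inside exit_mate.
- by rewrite face_outside.
- by rewrite face_hole.
- by rewrite face_crossing !boundary_inside exit_inward.
Qed.

(** The retraction sends a dart inside to the dart by which its face comes out; it
is [o], arbitrarily, on the inner faces. *)
Lemma boundary_faces (o : dart X) :
  (forall x x' : dart X,
     fconnect (@face _ D) (inl x) (inl x') = fconnect around x x') /\
  fcard (@face _ D) boundary_dart = fcard around (dart X).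
Proof.
pose r (d : dart D) := match d with
  | inl x => x
  | inr y => if exit w y is Some j then edge (pt X j) else o
  end.
apply: (fcard_section (h := inl) (r := r)) => //.
- exact: around_inj.
- exact: face_inj plug_shaded_map.
- exact: boundary_closed.
- move=> x; have [/codomP[i ->]|nx] := boolP (x \in codom (@pt _ _ X)).
    apply: connect_trans (fconnect1 _ _) _; rewrite face_pt around_pt.
    exact: face_exit (exit_mate ok i).
  by rewrite -face_outside // fconnect1.
- apply: plugP => [i|x nx|i|k s] _.
  + by rewrite face_pt /= exit_mate // -around_pt fconnect1.
  + by rewrite face_outside //= fconnect1.
  + by rewrite face_hole /= connect0.
  + by rewrite face_crossing /r exit_inward // connect0.
- case=> [x|y] /=; first by rewrite connect0.
  by rewrite unfold_in /=; case e: exit => [j|] // _; apply: face_exit.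
Qed.

Lemma faces_plug (o : dart X) :
  faces D = fcard around (dart X) + fcard (@face _ D) [predC boundary_dart].
Proof.
by rewrite /faces (n_compC boundary_dart) (boundary_faces o).2.
Qed.

Lemma faces_plug_open (o : dart X) : (forall y, exit w y != None) ->
  faces D = fcard around (dart X).
Proof.
move=> open; rewrite (faces_plug o) [X in _ + X](eq_n_comp_r (a' := pred0)).
  by rewrite [X in _ + X]eq_card0 ?addn0 // => x; rewrite !inE andbF.
by case=> [x|y]; rewrite !inE unfold_in //= open.
Qed.

Lemma faces_plug_closed (o : dart X) y0 : exit w y0 = None ->
    (forall y, exit w y = None -> exists n, y = iter n (inward w) y0) ->
  faces D = (fcard around (dart X)).+1.
Proof.
move=> e0 inner; rewrite (faces_plug o) -[RHS]addn1; congr (_ + _).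
have symf := face_sym plug_shaded_map.
rewrite -(n_comp_connect symf (inr y0)); apply: eq_n_comp_r => d.
rewrite inE; apply/idP/idP; last first.
  move=> c; rewrite -(closed_connect boundary_closed c) unfold_in /= e0.
  by [].
case: d => [//|y]; rewrite unfold_in /= negbK => /eqP/inner[n ->].
exact: face_inward.
Qed.

Lemma crossings_plug : #|@crossing _ D| =
  #|[pred x | (x \notin codom (@pt _ _ X)) && (node (node x) != x)]| + 4 * #|K|.
Proof.
rewrite -sum1_card big_sumType /= big_sumType /=; congr (_ + _).
  rewrite -sum1_card; apply: eq_bigl => x.
  rewrite -[RHS]/((x \notin codom (@pt _ _ X)) && (node (node x) != x)).
  rewrite -[LHS]/(node (node (inl x : dart D)) != inl x).
  have [/codomP[i ->]|nx] := boolP (x \in codom (@pt _ _ X)).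
    by rewrite node_pt node_hole eqxx.
  by rewrite !node_outside ?(out_node outX).
rewrite [X in _ + X]big_pred0 ?addn0 => [|i]; last first.
  by rewrite !unfold_in node_hole node_pt eqxx.
rewrite mulnC -[X in _ * X]card_ord -card_prod -sum1_card; apply: eq_bigl => -[k r].
rewrite !unfold_in !node_crossing.
apply: contraNneq (ordS2_neq r) => -[] /(congr1 val) e.
exact/eqP/val_inj.
Qed.

End PlugWired.

End Plug.

(** * Replacing a tangle *)

Section Replace.

Variables (L : eqType) (bar : L -> L).
Hypothesis barK : involutive bar.

(** The faces that meet the outside are the orbits of [around X] in both diagrams, so
the replacement loses one face, the inner one, and one crossing; this preserves
[4 * faces = crossing darts + 8].  Connectedness is preserved because the new
tangle joins all the ends. *)
Lemma plane_replace p (X : tangle L p.+1) (K K' : finType) (l : K -> L)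
    (l' : K' -> L) (w : seq (tdart K p.+1 * tdart K p.+1))
    (w' : seq (tdart K' p.+1 * tdart K' p.+1)) (o : dart X) y0 :
    (forall y, wiring_ok w y) -> (forall y, wiring_ok w' y) ->
    outside bar X ->
    exit w y0 = None ->
    (forall y, exit w y = None -> exists n, y = iter n (inward w) y0) ->
    (forall y, exit w' y != None) ->
    #|K| = #|K'|.+1 ->
    connected (wired bar l' w' [::]) ->
    plane bar (inl o : dart (plug X (wired bar l w [::]))) ->
  plane bar (inl o : dart (plug X (wired bar l' w' [::]))).
Proof.
move=> ok ok' outX e0 inner open cK conn' pl.
set D := plug X _ in pl; set D' := plug X _.
have M' : shaded_map bar D' by exact: plug_shaded_map.
have [fA _] := boundary_faces barK l ok outX o.
have [fA' _] := boundary_faces barK l' ok' outX o.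
have fE a b : fconnect (@face _ D) (inl a) (inl b) =
              fconnect (@face _ D') (inl a) (inl b) by rewrite fA fA'.
have joined_in y y' : joined (inr y : dart D') (inr y').
  pose T' := wired bar l' w' [::]; pose h (z : dart T') : dart D' := inr z.
  apply: (@joined_homo _ T' D' h _ _ y y' (conn' y y')) => z.
    exact: (joined_edge (inr z : dart D')).
  case: z => [[k r]|i]; last exact: connect0.
  have := joined_node (inr (inl (k, r)) : dart D').
  by rewrite (node_crossing bar X l' w' k r).
have joined_out a b : joined (inl a : dart D') (inl b).
  (* the whole old tangle is sent to one point of the new one *)
  pose h (d : dart D) : dart D' :=
    match d with inl x => inl x | inr _ => inr (inr ord0) end.
  apply: (@joined_homo _ D D' h _ _ (inl a) (inl b) (pl_connected pl _ _)) => d.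
    case: d => [x|y]; first exact: (joined_edge (inl x : dart D')).
    exact: connect0.
  move: d; apply: (plugP (l := l) (w := w)) => [i|x nx|i|k r].
  - rewrite (node_pt l w outX i) /h.
    apply: connect_trans (joined_node (inl (pt X i) : dart D')) _.
    by rewrite (node_pt l' w' outX i); apply: joined_in.
  - rewrite (node_outside bar l w nx) /h -(node_outside bar l' w' nx).
    exact: joined_node.
  - rewrite (node_hole bar X l w i) /h.
    apply: connect_trans (_ : joined _ (inr (inr i) : dart D')) _.
      exact: joined_in.
    by rewrite -(node_hole bar X l' w' i) -/(joined _ _) joined_node.
  - by rewrite (node_crossing bar X l w k r); apply: connect0.
split=> //.
- have hub d : joined (inr (inr ord0) : dart D') d.
    case: d => [x|y]; last exact: joined_in.
    apply: connect_trans (joined_node _) _.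
    by rewrite (node_hole bar X l' w'); apply: joined_out.
  by move=> x y; apply: connect_trans (hub y); rewrite -/(joined _ _) joined_sym hub.
- have := pl_euler pl.
  rewrite (faces_plug_closed barK l ok outX o e0 inner) (crossings_plug l w outX).
  rewrite (faces_plug_open barK l' ok' outX o open) (crossings_plug l' w' outX) cK.
  lia.
- exact: pl_outer pl.
- have fr (x y : option (dart X)) : tie x y || tie y x ->
      fconnect (@face _ D') (inl (odflt o x)) (inl (odflt o y)).
    move=> txy; rewrite -fE.
    have := @pl_frame _ _ _ _ pl (omap inl x) (omap inl y).
    case: x y txy => [a|] [b|] /= txy; apply; rewrite /neighbour /= orbA txy //.
  have fc (x y : dart D') : (y == face x) || (x == face y) ->
      fconnect (@face _ D') x y.
    case/orP=> /eqP->; first exact: fconnect1.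
    by rewrite (face_sym M') fconnect1.
  move=> [[a|y]|] [[b|z]|]; rewrite /neighbour /= 1?orbA.
  + by case/orP=> [/(fr (Some a) (Some b))|/(fc (inl a) (inl b))].
  + by move/(fc (inl a) (inr z)).
  + by rewrite orbF => /(fr (Some a) None).
  + by move/(fc (inr y) (inl b)).
  + by move/(fc (inr y) (inr z)).
  + by [].
  + by rewrite orbF => /(fr None (Some b)).
  + by [].
  + by move=> _; apply: connect0.
- exact: pl_shade_outer pl.
Qed.

End Replace.

(** * Cutting a diagram along a circle *)

Section Cut.

Variables (L : eqType) (bar : L -> L).
Hypothesis barK : involutive bar.
Implicit Types D E : diagram L.

(** Each dart of [s] gets a vertex of valence 2 of its own, next to it.  When [s]
contains both ends of an edge, that edge gets two vertices, and [sub_apart] says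
that they are different. *)
Record subdivision D D' (f : dart D -> dart D') (s : seq (dart D)) : Prop :=
  Subdivision {
  sub_inj : injective f;
  sub_node : forall d, node (f d) = f (node d);
  sub_lab : forall d, lab (f d) = lab d;
  sub_shade : forall d, shade (Some (f d)) = shade (Some d);
  sub_edge : forall d, d \notin s -> edge d \notin s -> edge (f d) = f (edge d);
  sub_edge_new : forall d, d \in s -> edge (f d) \notin codom f;
  sub_node_new : forall d, d \in s -> node (edge (f d)) \notin codom f;
  sub_node2 : forall d, d \in s -> node (node (edge (f d))) = edge (f d);
  sub_apart : forall d d', d \in s -> d' \in s ->
    node (edge (f d)) != edge (f d')
}.

Lemma subdivide_seq n D (o : dart D) (s : seq (dart D)) :
    size s = n -> plane bar o -> uniq s ->
  exists (D' : diagram L) (f : dart D -> dart D'),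
    [/\ plane bar (f o), isotopic bar D D' & subdivision f s].
Proof.
elim: n D o s => [|n IHn] D o [|d s] //= sz pl.
  move=> _; exists D, id; split=> //; [exact: Relation_Operators.rst_refl | by split].
case/andP=> ds us; case: sz => sz.
have [pl1 iso1] := subdivide d pl.
set D1 := subdivided o d in pl1 iso1.
pose i1 (x : dart D) : dart D1 := inl x.
have inj1 : injective i1 by move=> x y [].
have [D' [f [pl' iso' sub]]] := IHn D1 (inl o) (map i1 s)
  (etrans (size_map _ _) sz) pl1 (etrans (map_inj_uniq inj1 _) us).
have nf (b : bool) : f (inr b) \notin codom (f \o i1).
  by apply/codomP => -[x /(sub_inj sub)].
have nc y : y \notin codom f -> y \notin codom (f \o i1).
  by apply: contra => /codomP[x ->]; apply: codom_f.
have mem1 x : (i1 x \in map i1 s) = (x \in s) by rewrite mem_map.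
have new (b : bool) : (inr b : dart D1) \notin map i1 s.
  by apply/mapP => -[].
have ed : edge (f (i1 d)) = f (inr true).
  by rewrite (sub_edge sub) ?mem1 //= eqxx.
have nd : node (edge (f (i1 d))) = f (inr false) by rewrite ed (sub_node sub).
exists D', (f \o i1); split=> //; first exact: isotopic_trans (isotopic_sym iso1) iso'.
split.
- by move=> x y /(sub_inj sub)/inj1.
- by move=> x; rewrite /= (sub_node sub).
- by move=> x; rewrite /= (sub_lab sub).
- by move=> x; rewrite /= (sub_shade sub).
- move=> x; rewrite !inE !negb_or => /andP[xd xs] /andP[exd exs].
  have e1 : edge (i1 x) = i1 (edge x).
    rewrite /= (negbTE xd) -(inj_eq (edge_inj (pl_map pl))) (sm_edgeK (pl_map pl)).
    by rewrite (negbTE exd).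
  by rewrite /= (sub_edge sub) ?e1 ?mem1.
- move=> x; rewrite inE => /predU1P[->|xs]; first by rewrite /= ed nf.
  by apply/nc/(sub_edge_new sub); rewrite mem1.
- move=> x; rewrite inE => /predU1P[->|xs]; first by rewrite /= nd nf.
  by apply/nc/(sub_node_new sub); rewrite mem1.
- move=> x; rewrite inE => /predU1P[->|xs].
    by rewrite /= nd ed (sub_node sub).
  by apply: (sub_node2 sub); rewrite mem1.
- move=> x y; rewrite !inE => /predU1P[->|xs] /predU1P[->|ys].
  + by rewrite /= nd ed (inj_eq (sub_inj sub)).
  + rewrite /= nd; apply: contraNneq (sub_edge_new sub (_ : i1 y \in _)) => [<-|].
      exact: codom_f.
    by rewrite mem1.
  + rewrite /= ed; apply: contraNneq (sub_node_new sub (_ : i1 x \in _)) => [->|].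
      exact: codom_f.
    by rewrite mem1.
  + by apply: (sub_apart sub); rewrite mem1.
Qed.

Section Isomorphism.

Variables (D E : diagram L) (f : dart E -> dart D).
Hypotheses (MD : shaded_map bar D) (ME : shaded_map bar E).
Hypothesis bijf : bijective f.
Hypothesis fe : forall d, edge (f d) = f (edge d).
Hypothesis fn : forall d, node (f d) = f (node d).

Lemma isomorphism_faces :
  (forall x y, fconnect (@face _ D) (f x) (f y) = fconnect (@face _ E) x y) /\
  faces D = faces E.
Proof.
have [g gK fK] := bijf.
have ff x : face (f x) = f (face x) by rewrite /face fn fe.
apply: (@fcard_section _ _ _ _ (dart D) f g) => //.
- exact: face_inj ME.
- exact: face_inj MD.
- by move=> x; rewrite -ff fconnect1.
- by move=> y _; rewrite -{2}(fK y) ff gK fconnect1.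
- by move=> y _; rewrite fK.
Qed.

Lemma isomorphism_connected : connected D -> connected E.
Proof.
have [g gK fK] := bijf.
move=> conn x y; rewrite -(gK x) -(gK y).
apply: joined_homo (conn (f x) (f y)) => z.
  by rewrite -{2}(fK z) fe gK joined_edge.
by rewrite -{2}(fK z) fn gK joined_node.
Qed.

Lemma isomorphism_crossings : #|@crossing _ D| = #|@crossing _ E|.
Proof.
rewrite -(card_image (bij_inj bijf)); apply: eq_card => d.
have [g gK fK] := bijf; rewrite -(fK d) (mem_image (bij_inj bijf)).
by rewrite !unfold_in /crossing /= !fn (inj_eq (bij_inj bijf)).
Qed.

End Isomorphism.

(** Here [g] embeds the tangle in [D] so that each of its ends is one half of a vertex
of valence 2, the other half being outside; these vertices are where the
boundary of the disc crosses the strands. *)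
Section CutOut.

Variables (p : nat) (K : finType) (l : K -> L).
Variable w : seq (tdart K p * tdart K p).
Variables (D : diagram L) (o : dart D) (g : tdart K p -> dart D).
Hypotheses (pl : plane bar o) (ok : forall y, wiring_ok w y) (injg : injective g).
Hypothesis ge : forall y, edge (g y) = g (mate w y).
Hypothesis gn : forall k r, node (g (inl (k, r))) = g (inl (k, ordS r)).
Let T := wired bar l w [::].
Hypothesis gl : forall kr, lab (g (inl kr)) = lab (inl kr : dart T).
Hypothesis gs : forall y, shade (Some (g y)) = tangle_shade y.
Hypothesis gend : forall i, node (node (g (inr i))) = g (inr i).
Hypothesis gout : forall i, node (g (inr i)) \notin codom g.

Definition cut_dart := {d : dart D | d \notin codom g}.

(** Where [edge] or [node] would leave the complement, [insubd] gives the dart itself: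
this occurs for [node] at the ends only, where it has no meaning. *)
Definition cut_body : diagram L :=
  @Diagram L cut_dart
    (fun x => insubd x (edge (val x)))
    (fun x => insubd x (node (val x)))
    (fun x => lab (val x))
    (fun x => shade (omap val x))
    (tie_outside (fun x => fconnect (@face _ D) o (val x))).

Definition cut_pt (i : 'I_p) : dart cut_body := exist _ (node (g (inr i))) (gout i).

Definition cut : tangle L p := Tangle cut_pt.

Let M : shaded_map bar D := pl_map pl.

Lemma val_cut_edge (x : dart cut) : val (edge x) = edge (val x).
Proof.
rewrite val_insubd ifT //; apply: contra (valP x) => /codomP[y e].
by apply/codomP; exists (mate w y); rewrite -ge -e (sm_edgeK M).
Qed.

Lemma cut_node_out (x : dart cut) : x \notin codom cut_pt ->
  node (val x) \notin codom g.
Proof.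
move=> nx; apply/codomP => -[[[k r]|i] e].
  have : node (val x) = node (g (inl (k, ordS (ordS (ordS r))))).
    by rewrite gn ordS4.
  move/(node_inj M) => e'; have := valP x.
  by rewrite e' codom_f.
move: nx; rewrite -{1}(gend i) in e; move/(node_inj M): e => e.
by move/negP; apply; apply/codomP; exists i; apply: val_inj.
Qed.

Lemma val_cut_node (x : dart cut) : x \notin codom (@pt _ _ cut) ->
  val (node x) = node (val x).
Proof. by move=> nx; rewrite val_insubd ifT //; apply: cut_node_out. Qed.

Lemma cut_node_not_pt (x : dart cut) : x \notin codom (@pt _ _ cut) ->
  node x \notin codom (@pt _ _ cut).
Proof.
move=> nx; apply/codomP => -[i /(congr1 val)].
rewrite val_cut_node // => /(node_inj M) e; have := valP x.
by rewrite e codom_f.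
Qed.

Lemma cut_outside : outside bar cut.
Proof.
have she (x : dart cut) : shade (Some (edge x)) = ~~ shade (Some x).
  by rewrite /= val_cut_edge (sm_shade_edge M).
split=> //.
- move=> i j /(congr1 val)/(node_inj M)/injg; by case.
- by move=> x; apply: val_inj; rewrite !val_cut_edge (sm_edgeK M).
- by move=> x; rewrite -val_eqE /= val_cut_edge (sm_edge_free M).
- exact: cut_node_not_pt.
- move=> x nx; apply: val_inj; rewrite !val_cut_node ?cut_node_not_pt //.
  exact: sm_node4 M _.
- by move=> x nx; rewrite -val_eqE /= val_cut_node // (sm_node_free M).
- move=> x nx; rewrite -val_eqE /= !val_cut_node ?cut_node_not_pt //.
  exact: sm_labelled M _.
- move=> x nx; rewrite /= !val_cut_node ?cut_node_not_pt //.
  exact: sm_half_turn M _.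
- move=> i; have := sm_labelled M (node (g (inr i))).
  by rewrite crossingE gend eqxx /=; case: (lab _).
- move=> x nx; rewrite she /= val_cut_node // (shade_node M) negbK //.
- by move=> i; rewrite /= (shade_node M) gs negbK.
Qed.

Definition glue (d : dart (plug cut T)) : dart D :=
  match d with inl x => val x | inr y => g y end.

Lemma glue_edge d : edge (glue d) = glue (edge d).
Proof. by case: d => [x|y] /=; rewrite ?val_cut_edge ?ge. Qed.

Lemma glue_node d : node (glue d) = glue (node d).
Proof.
move: d; apply: (plugP (l := l) (w := w)) => [i|x nx|i|k r].
- by rewrite (node_pt l w cut_outside) /= gend.
- by rewrite node_outside //= val_cut_node.
- by rewrite (node_hole bar cut l w).
- by rewrite (node_crossing bar cut l w) /= gn.
Qed.

Lemma glue_bij : bijective glue.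
Proof.
apply: inj_card_bij.
  move=> [x|y] [x'|y'] /= e.
  - by congr inl; apply: val_inj.
  - by move: (valP x) => /=; rewrite e codom_f.
  - by move: (valP x') => /=; rewrite -e codom_f.
  - by rewrite (injg e).
rewrite card_sum card_sig addnC -(card_codom injg).
by rewrite -(cardC (mem (codom g))).
Qed.

(** The dart [o1] keeps the outer face outside of the disc: the point at infinity can
only be tied to a dart of the complement. *)
Lemma cut_isotopic (o1 : dart D) : fconnect (@face _ D) o o1 -> o1 \notin codom g ->
  exists o' : dart cut, plane bar (inl o' : dart (plug cut T)) /\
    isotopic bar D (plug cut T).
Proof.
move=> oo1 no1; pose o' : dart cut := exist _ o1 no1; exists o'.
have ME : shaded_map bar (plug cut T) by apply: plug_shaded_map cut_outside.
have [ff fF] := isomorphism_faces M ME glue_bij glue_edge glue_node.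
have fs d : shade (Some (glue d)) = shade (Some d).
  by case: d => [x|y] //=; rewrite gs.
have plE : plane bar (inl o' : dart (plug cut T)).
  apply: (@plane_tie_outside _ _ (plug cut T) (inl o')
    (fun d => if d is inl x then fconnect (@face _ D) o (val x) else false)) => //.
  - by case=> [[x|y]|] [[x'|y']|].
  - case=> [x|y] // ox; rewrite -ff; apply: connect_trans ox.
    by rewrite (face_sym M).
  - exact: isomorphism_connected glue_bij glue_edge glue_node (pl_connected pl).
  - rewrite -fF (pl_euler pl); congr (_ + 8).
    exact: isomorphism_crossings glue_bij glue_node.
  - rewrite /= (pl_shade_outer pl).
    apply: (fconnect_invariant (k := fun z => shade (Some z))) oo1 => z.
    by apply/eqP; apply: sm_shade_face M _.
split=> //; apply: isotopic_sym; apply: Relation_Operators.rst_step.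
split; [exact: plane_zero_box plE | exact: plane_zero_box pl | left].
exists glue; split.
- exact: glue_bij.
- exact: glue_edge.
- exact: glue_node.
- move=> [x|[kr|i]] //; first exact: gl.
  have := sm_labelled M (g (inr i)); rewrite crossingE gend eqxx /=.
  by case: (lab _).
- apply: same_places_plane pl plE fs ff _; exact: oo1.
Qed.

End CutOut.

End Cut.

(** * The context of a set of crossings *)

Section Context.

Variables (L : eqType) (bar : L -> L).
Hypothesis barK : involutive bar.

Variables (p : nat) (K : finType) (l : K -> L).
Variable w : seq (tdart K p * tdart K p).
Variables (D : diagram L) (o : dart D) (b : K -> dart D).
Hypotheses (pl : plane bar o) (ok : forall y, wiring_ok w y).
Hypothesis b_crossing : forall k, crossing (b k).
Hypothesis b_shade : forall k, shade (Some (b k)) = false.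
Hypothesis b_lab : forall k, lab (b k) = Some (l k).
Hypothesis b_apart : forall k k', k != k' -> ~~ fconnect (@node _ D) (b k) (b k').
Hypothesis ends_at_crossings : forall i, exists kr, mate w (inr i) = inl kr.

(** The dart [b k] is the upper left end of the crossing [k]; the ends are numbered
counterclockwise. *)
Definition corner_dart (kr : K * 'I_4) : dart D := iter kr.2 (@node _ D) (b kr.1).

Hypothesis b_wired : forall kr kr', mate w (inl kr) = inl kr' ->
  edge (corner_dart kr) = corner_dart kr'.
Hypothesis outer_not_inner : forall kr, exit w (inl kr) = None -> corner_dart kr != o.

Let M : shaded_map bar D := pl_map pl.

Lemma corner_dart_inj : injective corner_dart.
Proof.
move=> [k r] [k' r'] e; have [ek|nk] := eqVneq k k'; last first.
  case/negP: (b_apart nk).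
  apply: connect_trans (fconnect_iter _ r (b k) : connect _ _ (corner_dart (k, r))) _.
  by rewrite e (fconnect_sym (node_inj M)); apply: fconnect_iter.
rewrite -ek in e *; congr (_, _); apply: val_inj.
have order4 : order (@node _ D) (b k) = 4 by rewrite (order_node M) b_crossing.
rewrite -[LHS](@findex_iter _ (@node _ D) (b k) r) ?order4 //.
rewrite -[RHS](@findex_iter _ (@node _ D) (b k) r') ?order4 //.
exact: (congr1 (findex (@node _ D) (b k)) e).
Qed.

Lemma corner_dart_ordS k r : corner_dart (k, ordS r) = node (corner_dart (k, r)).
Proof.
case: r => [[|[|[|[|r]]]] i] //.
by rewrite /corner_dart /= (sm_node4 M).
Qed.

Lemma shade_corner_dart k r : shade (Some (corner_dart (k, r))) = odd r.
Proof.
rewrite /corner_dart /=; elim: (r : nat) => [|n IHn] /=; first exact: b_shade.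
by rewrite (shade_node M) IHn.
Qed.

Lemma lab_corner_dart kr :
  lab (corner_dart kr) = lab (inl kr : dart (wired bar l w [::])).
Proof.
case: kr => k r; have := shade_corner_dart k r.
have := sm_labelled M (corner_dart (k, r)).
case: r => [[|[|[|[|r]]]] i] //= h s; rewrite ?b_lab //.
- by move: h; rewrite s andbF; case: (lab _).
- by rewrite /corner_dart /= (sm_half_turn M) b_lab.
- by move: h; rewrite s andbF; case: (lab _).
Qed.

Definition end_dart (i : 'I_p) : dart D :=
  if mate w (inr i) is inl kr then corner_dart kr else o.

Lemma end_dartE i kr : mate w (inr i) = inl kr -> end_dart i = corner_dart kr.
Proof. by rewrite /end_dart => ->. Qed.

Lemma end_dart_inj : injective end_dart.
Proof.
move=> i j; have [kr ei] := ends_at_crossings i; have [kr' ej] := ends_at_crossings j.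
rewrite (end_dartE ei) (end_dartE ej) => /corner_dart_inj e.
have : mate w (inr i) = mate w (inr j) by rewrite ei ej e.
by move/(inv_inj (wiring_mateK ok)) => -[].
Qed.

(** The edges between ends of crossings that the wiring joins stay inside.  All the
others are cut, including those between two crossings of the tangle, which are
subdivided twice. *)
Lemma find_context : exists (X : tangle L p) (o' : dart X),
  [/\ outside bar X, plane bar (inl o' : dart (plug X (wired bar l w [::])))
    & isotopic bar D (plug X (wired bar l w [::]))].
Proof.
have mateK := wiring_mateK ok.
pose s := codom end_dart.
have us : uniq s by rewrite map_inj_uniq ?enum_uniq //; exact: end_dart_inj.
have es i : end_dart i \in s by apply: codom_f.
have [D' [f [pl' iso sub]]] := subdivide_seq (erefl (size s)) pl us.
have M' := pl_map pl'.
have not_s kr kr' : mate w (inl kr) = inl kr' -> corner_dart kr \notin s.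
  move=> e; apply/negP => /codomP [i e2].
  have [kr2 ei] := ends_at_crossings i.
  move: e2; rewrite (end_dartE ei) => /corner_dart_inj e2.
  by move: e; rewrite e2 -ei mateK.
pose g (y : tdart K p) : dart D' :=
  match y with inl kr => f (corner_dart kr) | inr i => edge (f (end_dart i)) end.
have ge y : edge (g y) = g (mate w y).
  case: y => [kr|i] /=.
    case e: (mate w (inl kr)) => [kr'|i] /=; last first.
      by rewrite (@end_dartE i kr) // -e mateK.
    rewrite -(b_wired e); apply: (sub_edge sub); first exact: not_s e.
    rewrite (b_wired e); by apply: (@not_s _ kr); rewrite -e mateK.
  have [kr ei] := ends_at_crossings i.
  by rewrite (sm_edgeK M') ei (end_dartE ei).
have gn k r : node (g (inl (k, r))) = g (inl (k, ordS r)).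
  by rewrite /= (sub_node sub) corner_dart_ordS.
have injg : injective g.
  move=> [kr|i] [kr'|j] /= e.
  - by congr inl; apply/corner_dart_inj/(sub_inj sub).
  - by have := sub_edge_new sub (es j); rewrite -e codom_f.
  - by have := sub_edge_new sub (es i); rewrite e codom_f.
  - by congr inr; apply/end_dart_inj/(sub_inj sub)/(edge_inj M').
have gl kr : lab (g (inl kr)) = lab (inl kr : dart (wired bar l w [::])).
  by rewrite /g (sub_lab sub) lab_corner_dart.
have gs y : shade (Some (g y)) = tangle_shade y.
  case: y => [[k r]|i] /=; first by rewrite (sub_shade sub) shade_corner_dart.
  have [[k r] ei] := ends_at_crossings i.
  rewrite (sm_shade_edge M') (sub_shade sub) (end_dartE ei) shade_corner_dart.
  by have := wiring_shade ok (inr i); rewrite ei /= => ->; rewrite negbK.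
have gend i : node (node (g (inr i))) = g (inr i) by exact: (sub_node2 sub (es i)).
have gout i : node (g (inr i)) \notin codom g.
  apply/codomP => -[[kr|j] e].
    by have := sub_node_new sub (es i); rewrite (e : node _ = f _) codom_f.
  by have := sub_apart sub (es i) (es j); rewrite (e : node _ = edge _) eqxx.
have facej j : face (g (inr j)) \notin codom g.
  apply: contra (gout j) => /codomP[y]; rewrite /face => e; apply/codomP.
  by exists (mate w y); rewrite -ge -e (sm_edgeK M').
have faceg y n : fconnect (@face _ D') (g y) (g (iter n (inward w) y)).
  elim: n => [|n IHn]; first exact: connect0.
  rewrite iterS; apply: connect_trans IHn _; case: (iter n _ y) => [[k r]|i].
    by rewrite /inward -ge -gn fconnect1.
  exact: connect0.
(* if [o] is one of the corners of the tangle, its face leaves the tangle *)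
have [o1 oo1 no1] : exists2 o1, fconnect (@face _ D') (f o) o1 & o1 \notin codom g.
  have [/codomP[y ey]|no] := boolP (f o \in codom g); last by exists (f o).
  case: y ey => [kr /(sub_inj sub) ekr|i e]; last first.
    by have := sub_edge_new sub (es i); rewrite -/(g (inr i)) -e codom_f.
  have := outer_not_inner (kr := kr); rewrite /exit -ekr eqxx.
  have := faceg (inl kr) 4.
  case: (iter 4 _ _) => [kr'|j] c; first by move/(_ erefl).
  move=> _; exists (face (g (inr j))); last exact: facej.
  rewrite ekr; apply: connect_trans c (fconnect1 _ _).
have [o' [plX isoX]] := cut_isotopic barK pl' ok injg ge gn gl gs gend gout oo1 no1.
exists (cut (f o) gout), o'; split=> //; last exact: isotopic_trans iso isoX.
exact: cut_outside.
Qed.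

End Context.

(** * Existence of a reducible face *)

Section SmallFace.

Variables (L : eqType) (bar : L -> L).

Lemma sum_order (T : finType) (f : T -> T) : injective f ->
  \sum_(r | froots f r) order f r = #|T|.
Proof.
move=> injf; have symf := fconnect_sym injf.
rewrite -sum1_card [RHS](partition_big (froot f) (fun r => froots f r)) /=; last first.
  by move=> x _; apply: fingraph.roots_root.
apply: eq_big => [//|r /eqP rr]; rewrite /order -sum1_card; apply: eq_bigl => x.
by rewrite -[in RHS]rr eq_sym fingraph.root_connect.
Qed.

Variables (D : diagram L) (o : dart D).
Hypotheses (pl : plane bar o) (cross : forall d : dart D, crossing d).

Let M : shaded_map bar D := pl_map pl.

Definition same_vertex (x y : dart D) := fconnect (@node _ D) x y.

Lemma same_vertex_sym : symmetric same_vertex.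
Proof. exact: fconnect_sym (node_inj M). Qed.

Lemma same_vertex_shade x y : same_vertex x y ->
  shade (Some x) = shade (Some y) -> y = x \/ y = node (node x).
Proof.
move=> xy; have := findex_max xy; rewrite (order_node M) cross.
have := iter_findex xy.
case: (findex _ x y) => [|[|[|[|n]]]] //= <- _; first by left.
- by rewrite (shade_node M); case: (shade _).
- by right.
- by rewrite !(shade_node M); case: (shade _).
Qed.

Lemma monogon_eq x y : face x = x -> fconnect (@face _ D) x y -> y = x.
Proof.
by move=> fx /iter_findex<-; elim: (findex _ _ _) => //= n ->.
Qed.

Definition inner_face (d : dart D) := ~~ fconnect (@face _ D) o d.

Definition reducible_face (d : dart D) :=
  [|| face d == d,
      (face (face d) == d) && ~~ same_vertex d (face d)
    | (face (face (face d)) == d) &&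
      [&& ~~ same_vertex d (face d), ~~ same_vertex (face d) (face (face d))
        & ~~ same_vertex (face (face d)) d]].

Hypothesis no_inner_monogon : forall d, inner_face d -> face d != d.

(** Corners of equal shade at a crossing are equal or opposite.  If [face x] is the
corner opposite to [x], the edge between them returns to the crossing at once,
and encloses the single corner [node x]. *)
Lemma self_touching_face x : inner_face x -> same_vertex x (face x) ->
  face x = node (node x) /\ o = node x.
Proof.
move=> ix xx; have e : face x = node (node x).
  case: (same_vertex_shade xx) => // [|e]; first by rewrite (sm_shade_face M).
  by move: (no_inner_monogon ix); rewrite e eqxx.
have mono : face (node x) = node x.
  by rewrite /face -e /face (sm_edgeK M).
split=> //; apply: monogon_eq (mono) _; rewrite (face_sym M).
by apply: contraTT isT => h; move: (no_inner_monogon h); rewrite mono eqxx.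
Qed.

End SmallFace.

Section ReducibleFace.

Variables (L : eqType) (bar : L -> L) (D : diagram L) (o : dart D).
Hypotheses (pl : plane bar o) (cross : forall d : dart D, crossing d).

(** If all the inner faces are bad, those of degree less than 4 touch themselves at
a crossing next to the outer face, which is then the monogon {[o]}: a bigon would
need two such monogons, and for a triangle this crossing is the one of [o], so
there is only one triangle.  Then the sum of 4 - degree is at most 3 + 1, not 8. *)
Lemma reducible_face_exists : exists d, inner_face o d && reducible_face d.
Proof.
have M := pl_map pl; have injf := face_inj M; have symf := face_sym M.
apply/existsP; apply: contraT => /existsPn bad.
have mono d : inner_face o d -> face d != d.
  by move=> id; move: (bad d); rewrite id /reducible_face; case: eqP.
(* the corner just before [o], on the face around the outer monogon *)
pose beta := node (node (node o)).
have touch x : inner_face o x -> same_vertex x (face x) -> x = beta.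
  move=> ix xx; have [_ ox] := self_touching_face pl cross mono ix xx.
  by rewrite /beta ox (sm_node4 M).
have inner_face1 x : inner_face o x -> inner_face o (face x).
  by rewrite /inner_face -same_fconnect1_r.
have weight r : froots (@face _ D) r -> 4 <= order (@face _ D) r +
    ((r == froot (@face _ D) o) * 3) + (r == froot (@face _ D) beta).
  move=> rr; have ord0 : 0 < order (@face _ D) r by apply: order_gt0.
  case: eqP => [_|/eqP ro]; first lia.
  have ir : inner_face o r.
    apply: contra ro; rewrite -(fingraph.root_connect symf) => /eqP->.
    by rewrite eq_sym.
  have ir1 := inner_face1 _ ir; have ir2 := inner_face1 _ ir1.
  have betar x : fconnect (@face _ D) r x -> x = beta ->
      r == froot (@face _ D) beta.
    by move=> rx <-; rewrite -{1}(eqP rr) fingraph.root_connect.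
  have := iter_order injf r; have := bad r; rewrite ir /reducible_face /=.
  case: (order _ r) ord0 => [|[|[|[|n]]]] //= _.
  - by move=> + e; rewrite e eqxx.
  - rewrite !negb_or => /and3P[_ + _] e; rewrite e eqxx /= negbK => rv.
    have [e1 o1] := self_touching_face pl cross mono ir rv.
    have rv2 : same_vertex (face r) (face (face r)) by rewrite e (same_vertex_sym pl).
    have [e2 o2] := self_touching_face pl cross mono ir1 rv2.
    by have := cross (node r); rewrite crossingE -e1 -o2 o1 eqxx.
  - rewrite !negb_or => /and3P[_ _ +] e; rewrite e eqxx /= !negb_and !negbK.
    case/or3P=> v.
    + by rewrite (betar r) // (touch r).
    + by rewrite (betar (face r)) ?fconnect1 // (touch (face r)).
    + rewrite (betar (face (face r))) ?(fconnect_iter _ 2) //.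
      by apply: touch; rewrite ?e.
have le : \sum_(r | froots (@face _ D) r) 4 <=
    \sum_(r | froots (@face _ D) r) (order (@face _ D) r +
    ((r == froot (@face _ D) o) * 3) + (r == froot (@face _ D) beta)).
  by apply: leq_sum.
have sum1 x : \sum_(r | froots (@face _ D) r) (r == froot (@face _ D) x) = 1.
  rewrite (bigD1 (froot (@face _ D) x)) /=; last exact: fingraph.roots_root.
  by rewrite eqxx big1 // => r /andP[_ /negbTE->].
move: le; rewrite big_split [X in _ <= X + _]big_split /= -big_distrl /=.
rewrite !sum1 (sum_order injf).
rewrite sum_nat_const => le.
have := pl_euler pl; have -> : #|@crossing _ D| = #|dart D|.
  by apply: eq_card => d; exact: cross.
have -> : faces D = #|froots (@face _ D)|.
  by rewrite /faces /n_comp_mem; apply: eq_card => x; rewrite !inE andbT.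
move: le; rewrite mulnC; move: #|froots _| #|dart D| => a b; lia.
Qed.

End ReducibleFace.

(** * Reduction of a face *)

Section Reduction.

Variables (L : eqType) (bar : L -> L).
Hypothesis barK : involutive bar.

(** The tangles that may be plugged instead of one with an inner face: [m] is the
number of crossings, and there is no inner face. *)
Definition connected_tangle p (m : nat) (T : tangle L p) : Prop :=
  exists (K : finType) (l : K -> L) (w : seq (tdart K p * tdart K p)),
    [/\ T = wired bar l w [::], forall y, wiring_ok w y,
        forall y, exit w y != None, connected T & #|K| = m].

Definition reduces p (D : diagram L) (T : tangle L p) (m : nat) : Prop :=
  exists X : tangle L p,
    [/\ injective (@pt _ _ X), isotopic bar D (plug X T)
      & forall T', connected_tangle m T' ->
          [/\ zero_box_axiom bar (plug X T'), connected (plug X T')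
            & #|@crossing _ (plug X T')| < #|@crossing _ D|]].

Lemma wired_connected p (K : finType) (l : K -> L) (k0 : K)
    (w : seq (tdart K p * tdart K p)) :
    (forall y, wiring_ok w y) ->
    (forall i, exists kr, mate w (inr i) = inl kr) ->
    (forall k, k = k0 \/ exists r r', mate w (inl (k0, r)) = inl (k, r')) ->
  connected (wired bar l w [::]).
Proof.
move=> ok ends links; set T := wired _ _ _ _.
have jr k (r : 'I_4) : joined (inl (k, r) : dart T) (inl (k, ord0)).
  have jn (s : 'I_4) : joined (inl (k, s) : dart T) (inl (k, ordS s)).
    exact: (joined_node (inl (k, s) : dart T)).
  rewrite joined_sym; move: {2}(val r) (erefl (val r)) => n.
  elim: n r => [|n IHn] r rn.
    have -> : r = ord0 by apply: val_inj.
    exact: connect0.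
  have ltn4 : n.+1 < 4 by rewrite -rn; exact: ltn_ord.
  have -> : r = ordS (inord n).
    by apply: val_inj; rewrite rn /= inordK ?modn_small // ltnW.
  by apply: connect_trans (IHn _ _) (jn _); rewrite /= inordK // ltnW.
have jk k r : joined (inl (k, r) : dart T) (inl (k0, ord0)).
  case: (links k) => [->|[s [s' e]]]; first exact: jr.
  apply: connect_trans (jr k r) _.
  apply: connect_trans (_ : joined _ (inl (k, s') : dart T)) _.
    by rewrite joined_sym.
  apply: connect_trans (jr k0 s).
  by rewrite -/(joined _ _) joined_sym -e; apply: (joined_edge (inl (k0, s) : dart T)).
have hub (y : dart T) : joined y (inl (k0, ord0)).
  case: y => [[k r]|i]; first exact: jk.
  have [[k r] e] := ends i; apply: connect_trans (jk k r).
  by rewrite -e; apply: (joined_edge (inr i : dart T)).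
move=> x y; apply: connect_trans (hub x) _.
by rewrite -/(joined _ _) joined_sym.
Qed.

Fixpoint all_wires (T : Type) (Q : T -> T -> Prop) (w : seq (T * T)) : Prop :=
  if w is e :: w' then Q e.1 e.2 /\ all_wires Q w' else True.

Lemma mate_wire (T : eqType) (w : seq (T * T)) y :
  [\/ mate w y = y, (y, mate w y) \in w | (mate w y, y) \in w].
Proof.
rewrite /mate; set s1 := [seq e.2 | e <- w & _]; set s2 := [seq e.1 | e <- w & _].
case E: (s1 ++ s2) => [|z s] /=; first by constructor 1.
have: z \in s1 ++ s2 by rewrite E mem_head.
rewrite mem_cat => /orP[] /mapP[[a b]]; rewrite mem_filter /= => /andP[/eqP-> h] ->.
  by constructor 2.
by constructor 3.
Qed.

Lemma all_wires_in (T : eqType) (Q : T -> T -> Prop) (w : seq (T * T)) a b :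
  all_wires Q w -> (a, b) \in w -> Q a b.
Proof.
elim: w => //= e w IHw [q /IHw{}IHw]; rewrite inE => /predU1P[e'|/IHw//].
by rewrite -e' in q.
Qed.

Section ReduceFace.

Variables (p m : nat) (K : finType) (l : K -> L).
Variable w : seq (tdart K p.+1 * tdart K p.+1).
Hypothesis cK : #|K| = m.+1.
Variables (D : diagram L) (o : dart D) (b : K -> dart D) (kr0 : K * 'I_4).
Hypotheses (pl : plane bar o) (cross : forall d : dart D, crossing d).
Hypothesis ok : forall y, wiring_ok w y.
Hypothesis ends : forall i, exists kr, mate w (inr i) = inl kr.
Hypothesis inner0 : exit w (inl kr0) = None.
Hypothesis inner : forall y, exit w y = None ->
  exists n, y = iter n (inward w) (inl kr0).
Hypothesis b_shade : forall k, shade (Some (b k)) = false.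
Hypothesis b_lab : forall k, lab (b k) = Some (l k).
Hypothesis b_apart : forall k k', k != k' -> ~~ same_vertex (b k) (b k').
Hypothesis b_wired : all_wires (fun y y' => match y, y' with
  | inl kr, inl kr' => edge (corner_dart b kr) = corner_dart b kr'
  | _, _ => True end) w.
Hypothesis b_inner : inner_face o (corner_dart b kr0).

(** [b_wired] is only asked for the wires as they are listed; the other direction
follows from [edge] being an involution. *)
Lemma reduce_face : reduces D (wired bar l w [::]) m.
Proof.
have M := pl_map pl.
have wiredb kr kr' : mate w (inl kr) = inl kr' ->
    edge (corner_dart b kr) = corner_dart b kr'.
  move=> e; have := mate_wire w (inl kr); rewrite e => -[e'|h|h].
  - by have := wiring_mate_free ok (inl kr); rewrite e e' eqxx.
  - exact: all_wires_in b_wired h.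
  - by rewrite -(all_wires_in b_wired h) (sm_edgeK M).
have trace n kr : iter n (inward w) (inl kr0) = inl kr ->
    fconnect (@face _ D) (corner_dart b kr0) (corner_dart b kr).
  elim: n kr => [kr [->]|n IHn kr]; first exact: connect0.
  rewrite iterS; case: (iter n _ _) IHn => [[k r]|//] /(_ _ erefl) IHn.
  rewrite /inward => /wiredb <-; apply: connect_trans IHn _.
  by rewrite (corner_dart_ordS b pl) fconnect1.
have [||X [o' [outX plX iso]]] :=
  find_context barK pl ok _ b_shade b_lab b_apart ends wiredb.
- by move=> k; apply: cross.
- move=> kr /inner[n /esym/trace c]; apply: contraNneq b_inner => <-.
  by rewrite (face_sym M).
exists X; split=> //; first exact: out_pt_inj outX.
move=> T' [K' [l' [w' [-> ok' open' conn' eK']]]].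
have eK : #|K| = #|K'|.+1 by rewrite eK' cK.
have plX' := plane_replace barK ok ok' outX inner0 inner open' eK conn' plX.
split; [exact: plane_zero_box plX' | exact: pl_connected plX' |].
rewrite (isotopic_invariants iso).1 (crossings_plug l w outX).
rewrite (crossings_plug l' w' outX).
by rewrite eK; lia.
Qed.

End ReduceFace.

End Reduction.

(** * The tangles of the relations *)

(** The strands of the tangles, apart from the labels, so that their properties can
be checked by computation on each dart. *)
Section Wirings.

Definition strand_wiring : seq (tdart void 2 * tdart void 2) :=
  [:: (A1 _, A2 _)].

Definition capped_above_wiring : seq (tdart unit 2 * tdart unit 2) :=
  [:: (UL _ tt, UR _ tt); (A1 _, LR _ tt); (A2 _, LL _ tt)].

Definition capped_right_wiring : seq (tdart unit 2 * tdart unit 2) :=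
  [:: (UR _ tt, LR _ tt); (A1 _, UL _ tt); (A2 _, LL _ tt)].

Definition box_wiring : seq (tdart unit 4 * tdart unit 4) :=
  [:: (t1 _, UL _ tt); (t2 _, UR _ tt); (b2 _, LR _ tt); (b1 _, LL _ tt)].

Definition stacked_wiring : seq (tdart bool 4 * tdart bool 4) :=
  [:: (t1 _, UL _ false); (t2 _, UR _ false); (LL _ false, UL _ true);
      (LR _ false, UR _ true); (b2 _, LR _ true); (b1 _, LL _ true)].

Definition beside_wiring : seq (tdart bool 4 * tdart bool 4) :=
  [:: (t1 _, UL _ false); (b1 _, LL _ false); (UR _ false, UL _ true);
      (LR _ false, LL _ true); (t2 _, UR _ true); (b2 _, LR _ true)].

Definition E2_wiring : seq (tdart bool 6 * tdart bool 6) :=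
  [:: (T1 _, UL _ false); (T2 _, UR _ false); (T3 _, LR _ false);
      (LL _ false, UL _ true);
      (B3 _, UR _ true); (B2 _, LR _ true); (B1 _, LL _ true)].

Definition E3_wiring : seq (tdart bool 6 * tdart bool 6) :=
  [:: (T2 _, UR _ false); (T3 _, LR _ false); (B3 _, LL _ false);
      (UL _ false, UR _ true);
      (T1 _, UL _ true); (B2 _, LR _ true); (B1 _, LL _ true)].

Definition above_wiring :
    seq (tdart (option bool) 6 * tdart (option bool) 6) :=
  [:: (T1 _, UL _ (Some false)); (UL _ None, UR _ (Some false));
      (B1 _, LL _ (Some false)); (LR _ (Some false), UR _ (Some true));
      (LL _ None, LR _ (Some true)); (B3 _, LL _ (Some true));
      (B2 _, UL _ (Some true)); (T2 _, UR _ None); (T3 _, LR _ None)].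

Definition below_wiring :
    seq (tdart (option bool) 6 * tdart (option bool) 6) :=
  [:: (T1 _, UL _ (Some false)); (T2 _, UR _ (Some false));
      (UL _ None, LL _ (Some false)); (LR _ (Some false), UR _ (Some true));
      (T3 _, LR _ (Some true)); (B3 _, LL _ (Some true));
      (UR _ None, UL _ (Some true)); (B2 _, LR _ None); (B1 _, LL _ None)].

Ltac each_dart y :=
  by case: y => [[[] [[|[|[|[|?]]]] ?]]|[[|[|[|[|[|[|?]]]]]] ?]] //; vm_compute.
Ltac each_dart3 y :=
  by case: y => [[[[]|] [[|[|[|[|?]]]] ?]]|[[|[|[|[|[|[|?]]]]]] ?]] //; vm_compute.

Lemma strand_ok y : wiring_ok strand_wiring y. Proof. each_dart y. Qed.
Lemma capped_above_ok y : wiring_ok capped_above_wiring y. Proof. each_dart y. Qed.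
Lemma capped_right_ok y : wiring_ok capped_right_wiring y. Proof. each_dart y. Qed.
Lemma box_ok y : wiring_ok box_wiring y. Proof. each_dart y. Qed.
Lemma stacked_ok y : wiring_ok stacked_wiring y. Proof. each_dart y. Qed.
Lemma beside_ok y : wiring_ok beside_wiring y. Proof. each_dart y. Qed.
Lemma E2_ok y : wiring_ok E2_wiring y. Proof. each_dart y. Qed.
Lemma E3_ok y : wiring_ok E3_wiring y. Proof. each_dart y. Qed.
Lemma above_ok y : wiring_ok above_wiring y. Proof. each_dart3 y. Qed.
Lemma below_ok y : wiring_ok below_wiring y. Proof. each_dart3 y. Qed.

Definition ends_ok (K : finType) p (w : seq (tdart K p * tdart K p)) (i : 'I_p) :=
  if mate w (inr i) is inl _ then true else false.

Lemma ends_okP (K : finType) p (w : seq (tdart K p * tdart K p)) :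
  (forall i, ends_ok w i) -> forall i, exists kr, mate w (inr i) = inl kr.
Proof.
move=> h i; move: (h i); rewrite /ends_ok.
by case: (mate w (inr i)) => [kr _|] //; exists kr.
Qed.

Ltac each_end i := by case: i => [[|[|[|[|[|[|?]]]]]] ?] //; vm_compute.

Lemma capped_above_ends i : ends_ok capped_above_wiring i. Proof. each_end i. Qed.
Lemma capped_right_ends i : ends_ok capped_right_wiring i. Proof. each_end i. Qed.
Lemma box_ends i : ends_ok box_wiring i. Proof. each_end i. Qed.
Lemma stacked_ends i : ends_ok stacked_wiring i. Proof. each_end i. Qed.
Lemma beside_ends i : ends_ok beside_wiring i. Proof. each_end i. Qed.
Lemma E2_ends i : ends_ok E2_wiring i. Proof. each_end i. Qed.
Lemma E3_ends i : ends_ok E3_wiring i. Proof. each_end i. Qed.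
Lemma above_ends i : ends_ok above_wiring i. Proof. each_end i. Qed.
Lemma below_ends i : ends_ok below_wiring i. Proof. each_end i. Qed.

(** The inner faces have at most three corners, so they are reached from one of them
in at most two steps. *)
Definition inner_ok (K : finType) p (w : seq (tdart K p * tdart K p)) y0 y :=
  (exit w y != None) || [|| y == y0, y == inward w y0 | y == inward w (inward w y0)].

Lemma inner_okP (K : finType) p (w : seq (tdart K p * tdart K p)) y0 :
  (forall y, inner_ok w y0 y) ->
  forall y, exit w y = None -> exists n, y = iter n (inward w) y0.
Proof.
move=> h y e; move: (h y); rewrite /inner_ok e /=.
by case/or3P=> /eqP->; [exists 0 | exists 1 | exists 2].
Qed.

Lemma capped_above_inner y : inner_ok capped_above_wiring (UR _ tt) y.
Proof. each_dart y. Qed.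
Lemma capped_right_inner y : inner_ok capped_right_wiring (LR _ tt) y.
Proof. each_dart y. Qed.
Lemma stacked_inner y : inner_ok stacked_wiring (LL _ false) y.
Proof. each_dart y. Qed.
Lemma beside_inner y : inner_ok beside_wiring (LR _ false) y.
Proof. each_dart y. Qed.
Lemma above_inner y : inner_ok above_wiring (LR _ (Some false)) y.
Proof. each_dart3 y. Qed.
Lemma below_inner y : inner_ok below_wiring (LL _ (Some false)) y.
Proof. each_dart3 y. Qed.

Lemma strand_open y : exit strand_wiring y != None. Proof. each_dart y. Qed.
Lemma box_open y : exit box_wiring y != None. Proof. each_dart y. Qed.
Lemma E2_open y : exit E2_wiring y != None. Proof. each_dart y. Qed.
Lemma E3_open y : exit E3_wiring y != None. Proof. each_dart y. Qed.

End Wirings.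

Section Tangles.

Variables (L : eqType) (bar : L -> L).
Hypothesis barK : involutive bar.

Lemma strand_connected : connected_tangle bar 0 (strand bar).
Proof.
exists void, (@no_label L), strand_wiring; split=> //.
- exact: strand_ok.
- exact: strand_open.
- have e := joined_edge (A1 _ : dart (strand bar)).
  have j1 : joined (A1 _ : dart (strand bar)) (A2 _) by move: e; vm_compute.
  have hub (y : dart (strand bar)) : joined (A1 _ : dart (strand bar)) y.
    case: y => [[[]]|[[|[|//]] i]].
      have -> : Ordinal i = @Ordinal 2 0 isT by apply: val_inj.
      exact: connect0.
    by have -> : Ordinal i = @Ordinal 2 1 isT by apply: val_inj.
  by move=> x y; apply: connect_trans (hub y); rewrite -/(joined _ _) joined_sym.
- by rewrite card_void.
Qed.

Lemma box_connected i : connected_tangle bar 1 (p_box bar i).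
Proof.
exists unit, (label1 i), box_wiring; split=> //.
- exact: box_ok.
- exact: box_open.
- apply: (@wired_connected _ _ _ _ _ tt); first exact: box_ok.
    exact: ends_okP box_ends.
  by case; left.
- by rewrite card_unit.
Qed.

Lemma E2_connected s t : connected_tangle bar 2 (E2 bar s t).
Proof.
exists bool, (label2 s t), E2_wiring; split=> //.
- exact: E2_ok.
- exact: E2_open.
- apply: (@wired_connected _ _ _ _ _ false); first exact: E2_ok.
    exact: ends_okP E2_ends.
  case; last by left.
  by right; exists (@Ordinal 4 1 isT), (@Ordinal 4 0 isT); vm_compute.
- by rewrite card_bool.
Qed.

Lemma E3_connected s t : connected_tangle bar 2 (E3 bar s t).
Proof.
exists bool, (label2 s t), E3_wiring; split=> //.
- exact: E3_ok.
- exact: E3_open.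
- apply: (@wired_connected _ _ _ _ _ false); first exact: E3_ok.
    exact: ends_okP E3_ends.
  case; last by left.
  by right; exists (@Ordinal 4 0 isT), (@Ordinal 4 3 isT); vm_compute.
- by rewrite card_bool.
Qed.

Variables (D : diagram L) (o d : dart D).
Hypotheses (pl : plane bar o) (cross : forall x : dart D, crossing x).
Hypotheses (inner : inner_face o d).

Let M : shaded_map bar D := pl_map pl.

Lemma label_of (x : dart D) : shade (Some x) = false -> exists i, lab x = Some i.
Proof.
by move=> s; have := sm_labelled M x; rewrite cross s; case: (lab x) => // i; exists i.
Qed.

Lemma same_vertex_node (x y : dart D) : same_vertex x (node y) = same_vertex x y.
Proof. by rewrite /same_vertex -(same_fconnect1_r (node_inj M)). Qed.

Lemma same_vertex_nodel (x y : dart D) : same_vertex (node x) y = same_vertex x y.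
Proof. by rewrite /same_vertex -(same_fconnect1 (node_inj M)). Qed.

(** In the three reductions the upper left ends of the crossings are chosen so that
[d] is the corner of the small face at the first crossing of the tangle: in the
shaded case its number there is 3 for a monogon and 1 otherwise, in the unshaded
case it is 2.  The labels are then read off at the upper left ends, whose
corners are unshaded. *)
Lemma reduce_monogon : face d = d ->
  exists i, reduces bar D (p_capped_above bar i) 0 \/
            reduces bar D (p_capped_right bar i) 0.
Proof.
move=> fd.
case sd: (shade (Some d)).
  have sb : shade (Some (node d)) = false by rewrite (shade_node M) sd.
  have [i li] := label_of sb; exists i; left.
  apply: (reduce_face barK card_unit (b := fun _ => node d)
    (kr0 := (tt, @Ordinal 4 3 isT)) pl) => //.
  - exact: capped_above_ok.
  - exact: ends_okP capped_above_ends.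
  - exact: inner_okP capped_above_inner.
  - by rewrite /= /corner_dart /= (sm_node4 M).
  - by rewrite /corner_dart /= (sm_node4 M).
have sb : shade (Some (node (node d))) = false by rewrite !(shade_node M) sd.
have [i li] := label_of sb; exists i; right.
apply: (reduce_face barK card_unit (b := fun _ => node (node d))
  (kr0 := (tt, @Ordinal 4 2 isT)) pl) => //.
- exact: capped_right_ok.
- exact: ends_okP capped_right_ends.
- exact: inner_okP capped_right_inner.
- by rewrite /= /corner_dart /= !(sm_node4 M).
- by rewrite /corner_dart /= (sm_node4 M).
Qed.

Lemma reduce_bigon : face (face d) = d -> ~~ same_vertex d (face d) ->
  exists i j, reduces bar D (p_stacked bar i j) 1 \/
              reduces bar D (p_beside bar i j) 1.
Proof.
move=> ffd v.
have sf : shade (Some (face d)) = shade (Some d) by exact: sm_shade_face M d.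
have v' : ~~ same_vertex (face d) d by rewrite (same_vertex_sym pl).
case sd: (shade (Some d)).
  have sb1 : shade (Some (node (node (node d)))) = false by rewrite !(shade_node M) sd.
  have sb2 : shade (Some (node (face d))) = false by rewrite (shade_node M) sf sd.
  have [i li] := label_of sb1; have [j lj] := label_of sb2.
  exists i, j; left.
  apply: (reduce_face barK card_bool
    (b := fun k : bool => if k then node (face d) else node (node (node d)))
    (kr0 := (false, @Ordinal 4 1 isT)) pl) => //.
  - exact: stacked_ok.
  - exact: ends_okP stacked_ends.
  - exact: inner_okP stacked_inner.
  - by case.
  - by case.
  - by case; case=> //= _; rewrite !(same_vertex_node, same_vertex_nodel).
  - rewrite /= /corner_dart /= !(sm_node4 M); do !split => //.
    by rewrite -{1}ffd /face (sm_edgeK M).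
  - by rewrite /corner_dart /= (sm_node4 M).
have sb1 : shade (Some (node (node d))) = false by rewrite !(shade_node M) sd.
have sb2 : shade (Some (face d)) = false by rewrite sf sd.
have [i li] := label_of sb1; have [j lj] := label_of sb2.
exists i, j; right.
apply: (reduce_face barK card_bool
  (b := fun k : bool => if k then face d else node (node d))
  (kr0 := (false, @Ordinal 4 2 isT)) pl) => //.
- exact: beside_ok.
- exact: ends_okP beside_ends.
- exact: inner_okP beside_inner.
- by case.
- by case.
- by case; case=> //= _; rewrite !(same_vertex_node, same_vertex_nodel).
- rewrite /= /corner_dart /= !(sm_node4 M); do !split => //.
  by rewrite -{1}ffd /face (sm_edgeK M).
- by rewrite /corner_dart /= (sm_node4 M).
Qed.

Lemma reduce_triangle : face (face (face d)) = d ->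
    ~~ same_vertex d (face d) -> ~~ same_vertex (face d) (face (face d)) ->
    ~~ same_vertex (face (face d)) d ->
  exists i j k, reduces bar D (E1_above bar i j k) 2 \/
                reduces bar D (E1_below bar i j k) 2.
Proof.
set d' := face d; set d'' := face d' => fd v1 v2 v3.
have c3 : #|{: option bool}| = 3 by rewrite card_option card_bool.
have sf : shade (Some d') = shade (Some d) by exact: sm_shade_face M d.
have sf' : shade (Some d'') = shade (Some d) by rewrite -sf; exact: sm_shade_face M d'.
have v1' : ~~ same_vertex d' d by rewrite (same_vertex_sym pl).
have v2' : ~~ same_vertex d'' d' by rewrite (same_vertex_sym pl).
have v3' : ~~ same_vertex d d'' by rewrite (same_vertex_sym pl).
have e1 : edge (node d) = d' by [].
have e2 : edge (node d') = d'' by [].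
have e3 : edge (node d'') = d by [].
have e1' : edge d' = node d by rewrite -e1 (sm_edgeK M).
have e2' : edge d'' = node d' by rewrite -e2 (sm_edgeK M).
have e3' : edge d = node d'' by rewrite -{1}e3 (sm_edgeK M).
case sd: (shade (Some d)).
  have sb1 : shade (Some (node (node (node d)))) = false by rewrite !(shade_node M) sd.
  have sb2 : shade (Some (node d')) = false by rewrite (shade_node M) sf sd.
  have sb3 : shade (Some (node d'')) = false by rewrite (shade_node M) sf' sd.
  have [i li] := label_of sb1; have [j lj] := label_of sb2; have [k lk] := label_of sb3.
  exists i, j, k; right.
  apply: (reduce_face barK c3
    (b := fun x : option bool => if x is Some y then
       if y then node d' else node (node (node d)) else node d'')
    (kr0 := (Some false, @Ordinal 4 1 isT)) pl) => //.
  - exact: below_ok.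
  - exact: ends_okP below_ends.
  - exact: inner_okP below_inner.
  - by case=> [[]|].
  - by case=> [[]|].
  - by case=> [[]|] [[]|] //= _; rewrite !(same_vertex_node, same_vertex_nodel).
  - by rewrite /= /corner_dart /= !(sm_node4 M); do !split.
  - by rewrite /corner_dart /= (sm_node4 M).
have sb1 : shade (Some (node (node d))) = false by rewrite !(shade_node M) sd.
have sb2 : shade (Some (node (node d''))) = false by rewrite !(shade_node M) sf' sd.
have sb3 : shade (Some d') = false by rewrite sf sd.
have [i li] := label_of sb1; have [j lj] := label_of sb2; have [k lk] := label_of sb3.
exists i, j, k; left.
apply: (reduce_face barK c3
  (b := fun x : option bool => if x is Some y then
     if y then node (node d'') else node (node d) else d')
  (kr0 := (Some false, @Ordinal 4 2 isT)) pl) => //.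
- exact: above_ok.
- exact: ends_okP above_ends.
- exact: inner_okP above_inner.
- by case=> [[]|].
- by case=> [[]|].
- by case=> [[]|] [[]|] //= _; rewrite !(same_vertex_node, same_vertex_nodel).
- by rewrite /= /corner_dart /= !(sm_node4 M); do !split.
- by rewrite /corner_dart /= (sm_node4 M).
Qed.

End Tangles.

(** * Diagrams without crossings *)

Section BaseCase.

Variables (L : eqType) (bar : L -> L).

Definition empty_diagram (b : bool) : diagram L :=
  @Diagram L void id id (fun _ => None) (fun _ => b) (fun _ _ => false).

Lemma empty_diagram_zero_box b : zero_box_axiom bar (empty_diagram b).
Proof.
have n0 (e : rel void) : n_comp e predT = 0 by apply: eq_card0 => -[].
split; try by case.
- by rewrite /vertices /faces /edges /components !n0.
- rewrite /components /faces !n0 add0n add0n /regions.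
  apply: etrans (n_comp_connect (sym_connect_sym
    (@neighbour_sym _ (empty_diagram b))) None).
  by apply: eq_n_comp_r => -[[]|]; rewrite [RHS]connect0.
Qed.

(** In normal form a vertex of valence 2 is a whole component, hence everything. *)
Lemma crossing_or_circle (D : diagram L) (o : dart D) :
    plane bar o -> (forall u : dart D, node (node u) = u -> edge u = node u) ->
  (forall d : dart D, crossing d) \/
  isotopic bar D (@add_circle L (empty_diagram (shade (None : option (dart D)))) None).
Proof.
move=> pl normal; have M := pl_map pl.
have [/forallP|/forallPn[u]] := boolP [forall d : dart D, crossing d]; first by left.
rewrite negbK => /eqP nnu; right.
have eu := normal u nnu.
have two d : d = u \/ d = node u.
  have : d \in pred2 u (node u).
    have clo : closed (@adjacent _ D) (pred2 u (node u)).
      apply: intro_closed; first exact: sym_connect_sym (@adjacent_sym _ D).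
      move=> x y.
      have en : edge (node u) = u by rewrite -eu (sm_edgeK M).
      rewrite !inE /adjacent /= => xy /orP[]/eqP ex; move: xy; rewrite ex ?nnu ?en ?eu.
      - case/or4P=> /eqP;
          [by move->; rewrite eqxx orbT| |by move->; rewrite eqxx orbT|].
          by move=> e; rewrite -[y](sm_edgeK M) -e eu eqxx orbT.
        by move=> e; rewrite -[y](sm_node4 M) -e nnu eqxx orbT.
      - case/or4P=> /eqP; [by move->; rewrite eqxx| |by move->; rewrite eqxx|].
          by move=> e; rewrite -[y](sm_edgeK M) -e en eqxx.
        by move=> e; rewrite -[y](sm_node4 M) -e nnu nnu eqxx.
    rewrite -(closed_connect clo (pl_connected pl u d)).
    by rewrite !inE eqxx.
  by rewrite !inE => /orP[]/eqP->; [left|right].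
have nno : node (node o) = o by case: (two o) => ->; rewrite nnu.
have eo := normal o nno.
have {}two d : d = o \/ d = node o.
  by case: (two d) (two o) => -> [] ->; rewrite ?nnu; auto.
set E := add_circle _.
pose f (x : dart E) : dart D :=
  match x with inl v => match v with end | inr b => if b then o else node o end.
have no := sm_node_free M o.
have bijf : bijective f.
  exists (fun d => if d == o then inr true else inr false) => [[[]|[]] /=|d].
  - by rewrite eqxx.
  - by rewrite (negbTE no).
  - by case: (two d) => ->; rewrite ?eqxx ?(negbTE no).
have fe d : edge (f d) = f (edge d).
  by case: d => [[]|[]] //=; rewrite -eo (sm_edgeK M).
have fn d : node (f d) = f (node d) by case: d => [[]|[]] //=.
have sO := pl_shade_outer pl.
have fs d : shade (Some (f d)) = shade (Some d).
  by case: d => [[]|[]] //=; rewrite ?(shade_node M) sO.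
have fl d : lab (f d) = lab d.
  have := sm_labelled M (f d); rewrite crossingE !fn.
  by case: d => [[]|[]] /=; rewrite eqxx; case: (lab _).
have ME : shaded_map bar E.
  split=> //; try by move=> [[]|[]].
  by move=> [[]|[]] //=; rewrite negbK.
have [ff fF] := isomorphism_faces M ME bijf fe fn.
have plE : plane bar (inr true : dart E).
  apply: (@plane_tie_outside _ _ E (inr true) (pred1 (inr true))) => //.
  - by move=> [[[]|[]]|] [[[]|[]]|].
  - by move=> d /eqP->; apply: connect0.
  - exact: isomorphism_connected bijf fe fn (pl_connected pl).
  - by rewrite -fF (pl_euler pl) (isomorphism_crossings bijf fn).
apply: isotopic_sym; apply: Relation_Operators.rst_step.
split; [exact: plane_zero_box plE | exact: plane_zero_box pl | left].
exists f; split=> //.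
by apply: same_places_plane pl plE fs ff _; apply: connect0.
Qed.

End BaseCase.

(** * Evaluation paths *)

Section Evaluation.

Variables (R : realType) (n : nat) (P : exchange_data R n).
Local Notation zbox := (zero_box (bar P)).

Lemma evaluation_path_cat ms ms' (s u v : comb R zbox) :
    evaluation_path ms s u -> evaluation_path ms' u v ->
  evaluation_path (ms ++ ms') s v.
Proof. by elim=> //= *; apply: path_cons; eauto. Qed.

Lemma evaluation_path_context ms (s u a b : comb R zbox) :
  evaluation_path ms s u -> evaluation_path ms (a ++ s ++ b) (a ++ u ++ b).
Proof.
elim=> [?|m {}ms s1 c D s2 s' {}u mv _ IH]; first exact: path_nil.
rewrite -catA cat_cons catA; apply: path_cons mv _.
by rewrite -!catA in IH *.
Qed.

Lemma comb_scale_cat (A : Type) c (s t : comb R A) :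
  comb_scale c (s ++ t) = comb_scale c s ++ comb_scale c t.
Proof. exact: map_cat. Qed.

Lemma comb_scale_scale (A : Type) c d (s : comb R A) :
  comb_scale c (comb_scale d s) = comb_scale (c * d)%R s.
Proof.
by rewrite /comb_scale -map_comp; apply: eq_map => x /=; rewrite GRing.mulrA.
Qed.

Lemma evaluation_path_scale ms c (s u : comb R zbox) :
  evaluation_path ms s u -> evaluation_path ms (comb_scale c s) (comb_scale c u).
Proof.
elim=> [?|m {}ms s1 d D s2 s' {}u mv _ IH]; first exact: path_nil.
rewrite comb_scale_cat /=; apply: path_cons mv _.
by rewrite !comb_scale_cat comb_scale_scale in IH.
Qed.

Definition evaluable (b : bool) (s : comb R zbox) : Prop :=
  exists ms u, [/\ canonical ms, evaluation_path ms s u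
    & all (fun x => is_empty_diagram b x.2) u].

Lemma canonical_cat ms ms' : canonical ms -> canonical ms' -> canonical (ms ++ ms').
Proof.
by rewrite /canonical !mem_cat !negb_or => /andP[-> ->] /andP[-> ->].
Qed.

Lemma all_comb_scale b c (u : comb R zbox) :
  all (fun x => is_empty_diagram b x.2) (comb_scale c u) =
  all (fun x => is_empty_diagram b x.2) u.
Proof. by rewrite all_map; apply: eq_all. Qed.

(** The terms are evaluated one after the other; a path for one term is scaled by
its coefficient and applied with the other terms as bystanders. *)
Lemma evaluable_terms b (s : comb R zbox) :
    (forall y, List.In y s -> evaluable b [:: (1%R, y.2)]) -> evaluable b s.
Proof.
elim: s => [_|[c D] s IHs ev]; first by exists [::], [::]; split=> //; apply: path_nil.
have [|ms [u [cms pms au]]] := IHs; first by move=> y ys; apply: ev; right.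
have [ms' [u' [cms' pms' au']]] := ev _ (or_introl erefl).
exists (ms' ++ ms), (comb_scale c u' ++ u); split; first exact: canonical_cat.
  apply: evaluation_path_cat (_ : evaluation_path ms' _ (comb_scale c u' ++ s)) _.
    have := evaluation_path_context [::] s (evaluation_path_scale c pms').
    by rewrite /= GRing.mulr1.
  by have := evaluation_path_context (comb_scale c u') [::] pms; rewrite !cats0.
by rewrite all_cat all_comb_scale au' au.
Qed.

Lemma evaluable_move b m (D : zbox) (s : comb R zbox) :
    m \notin [:: 4; 5] -> move m D s -> evaluable b s ->
  evaluable b [:: (1%R, D)].
Proof.
rewrite !inE negb_or => /andP[m4 m5] mv [ms [u [cms pms au]]].
exists (m :: ms), u; split=> //.
  by move: cms; rewrite /canonical !inE !negb_or !(eq_sym _ m) m4 m5.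
apply: (@path_cons _ _ _ m ms [::] 1%R D [::] s u mv) => /=.
rewrite cats0; have -> // : comb_scale 1%R s = s.
by rewrite /comb_scale -[RHS]map_id; apply: eq_map => -[x y] /=; rewrite GRing.mul1r.
Qed.

Lemma evaluable_replacement p (T : tangle 'I_n.+1 p) k m (D : zbox) (A : Type)
    (tg : A -> tangle 'I_n.+1 p) (r : comb R A) :
    reduces (bar P) D T k -> (forall a, connected_tangle (bar P) k (tg a)) ->
    m \notin [:: 4; 5] ->
    (forall s, replaces T (comb_map tg r) D s -> move m D s) ->
    (forall E : zbox, connected E -> #|@crossing _ E| < #|@crossing _ D| ->
      evaluable (shade (None : option (dart E))) [:: (1%R, E)]) ->
  evaluable (shade (None : option (dart D))) [:: (1%R, D)].
Proof.
move=> [X [injX iso red]] tgc m45 mv IH.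
have Z a : zero_box_axiom (bar P) (plug X (tg a)) by have [] := red _ (tgc a).
pose box a : zbox := ZeroBox (Z a).
have repl : replaces T (comb_map tg r) D (comb_map box r).
  exists X; split=> //; elim: (r) => [|x r' IHr] /=; first exact: List.Forall2_nil.
  apply: List.Forall2_cons => //; split=> //; exact: Relation_Operators.rst_refl.
apply: evaluable_move m45 (mv _ repl) _; apply: evaluable_terms => y.
elim: (r) => //= x r' IHr [<-|/IHr//] /=.
have [_ conn lt] := red _ (tgc x.2).
by rewrite (isotopic_invariants iso).2; apply: IH (box x.2) conn lt.
Qed.

(** Moves are insensitive to isotopy, so the reductions are found in the normal form
of [D] and applied to [D]. *)
Lemma connected_evaluable (D : zbox) : connected D ->
  evaluable (shade (None : option (dart D))) [:: (1%R, D)].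
Proof.
have [N] := ubnP #|@crossing _ D|; elim: N D => // N IHN D ltN conn.
have IH (E : zbox) : connected E -> #|@crossing _ E| < #|@crossing _ D| ->
    evaluable (shade (None : option (dart E))) [:: (1%R, E)].
  by move=> cE lt; apply: IHN cE; apply: leq_trans lt _.
have [/eqP D0|] := boolP (#|dart D| == 0).
  exists [::], [:: (1%R, D)]; split=> //; first exact: path_nil.
  by rewrite /= /is_empty_diagram D0 !eqxx.
rewrite -lt0n => /card_gt0P[d0 _].
have [o0 pl0] := zero_box_plane d0 (zb_axiom D) conn.
have [E [o [pl iso normal]]] := normalize pl0.
have [cE shE] := isotopic_invariants iso.
have red p (T : tangle 'I_n.+1 p) k : reduces (bar P) E T k -> reduces (bar P) D T k.
  case=> X [injX isoX rX]; exists X; split=> //; first exact: isotopic_trans iso isoX.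
  by rewrite cE.
have [cross|circ] := crossing_or_circle pl normal; last first.
  have Z := empty_diagram_zero_box (bar P) (shade (None : option (dart E))).
  apply: (@evaluable_move _ 0 D [:: (delta P, ZeroBox Z)]) => //.
    exact: (@Move0 _ _ P D (ZeroBox Z) None (isotopic_trans iso circ)).
  exists [::], [:: (delta P, ZeroBox Z)]; split=> //; first exact: path_nil.
  by rewrite /= /is_empty_diagram shE eqxx card_void.
have barKP := @barK _ _ P.
have [d /andP[inner]] := reducible_face_exists pl cross.
case/or3P=> [/eqP f1|/andP[/eqP f2 v]|/andP[/eqP f3 /and3P[v1 v2 v3]]].
- have [i [/red ri|/red ri]] := reduce_monogon barKP pl cross inner f1.
  + apply: (@evaluable_replacement _ _ _ 1 D _ (fun _ : unit => strand (bar P))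
      ([:: (cap_c P i, tt)]) ri) => //.
      by move=> _; apply: strand_connected.
    by move=> s; apply: Move1_above.
  + apply: (@evaluable_replacement _ _ _ 1 D _ (fun _ : unit => strand (bar P))
      ([:: (cap_d P i, tt)]) ri) => //.
      by move=> _; apply: strand_connected.
    by move=> s; apply: Move1_right.
- have [i [j [/red ri|/red ri]]] := reduce_bigon barKP pl cross inner f2 v.
  + apply: (@evaluable_replacement _ _ _ 2 D _ (p_box (bar P))
      (product R i j) ri) => //; first exact: box_connected.
    by move=> s; apply: Move2_shaded.
  + apply: (@evaluable_replacement _ _ _ 2 D _ (p_box (bar P))
      (convolution P i j) ri) => //; first exact: box_connected.
    by move=> s; apply: Move2_unshaded.
have exch x : connected_tangle (bar P) 2 (exchanged_tangle P x).
  by case: x => [s t|s t]; [exact: E2_connected | exact: E3_connected].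
have [i [j [k [/red ri|/red ri]]]] := reduce_triangle barKP pl cross inner f3 v1 v2 v3.
- apply: (@evaluable_replacement _ _ _ 3 D _ (exchanged_tangle P)
      (comb_bind (exchange P i j) (two_face_above P k)) ri) => //.
  by move=> s; apply: Move3_unshaded.
- apply: (@evaluable_replacement _ _ _ 3 D _ (exchanged_tangle P)
      (comb_bind (exchange P i j) (two_face_below R k)) ri) => //.
  by move=> s; apply: Move3_shaded.
Qed.

End Evaluation.

Theorem theorem3p4 (R : realType) (n : nat) (P : exchange_data R n)
    (D : zero_box (bar P)) :
  connected D ->
  exists (Z : R[i]) (ms : seq nat), canonical ms /\ evaluates_to ms D Z.
Proof.
move=> /connected_evaluable[ms [u [cms pms au]]].
by exists (\sum_(x <- u) x.1)%R, ms; split=> //; exists u.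
Qed.
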